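(* (1) There are exactly 2 isomorphism classes of hyperfields of order 2, namely those of the Krasner hyperfield $\mathbb{K}$ and of the finite field $\mathbb{F}_2$. Both of them are quotients of finite fields. (2) Every hyperfield of order 3 is a quotient of a field. More precisely, there are exactly 5 isomorphism classes of hyperfields of order 3, all but one of which are isomorphic to quotients of finite fields. The hyperfield of signs $\mathbb{S}$ is isomorphic to $\mathbb{R}/\mathbb{R}_{>0}$ but not to any quotient of a finite field. (3) There are exactly 7 isomorphism classes of hyperfields of order 4. Of these, 4 are quotients of finite fields, 1 is a quotient of an infinite field but not of any finite field, and the remaining 2 are not quotients of any field.
   Context: A hyperoperation on a set $F$ is a function $\boxplus: F\times F\to \mathcal{P}(F)$ to the power set of $F$ such that $a\boxplus b\neq\emptyset$ for all $a,b\in F$. It is commutative if $a\boxplus b=b\boxplus a$ for all $a,b\in F$, and associative if $\bigcup_{d\in b\boxplus c} a\boxplus d=\bigcup_{d\in a\boxplus b} d\boxplus c$ for all $a,b,c\in F$. A hypergroup is a set $G$ with an associative hyperoperation $\boxplus$ such that: (i) there is an element $0\in G$ with $0\boxplus a=a\boxplus 0=\{a\}$ for all $a\in G$; (ii) for every $a \in G$ there is a unique element $-a\in G$ with $0\in a\boxplus(-a)$; (iii) for all $a,b,c \in G$, $a\in b\boxplus c$ if and only if $-b\in(-a)\boxplus c$. It is commutative if $\boxplus$ is commutative. A hyperfield is a set $\mathbb{H}$ with a binary operation $\cdot$, a hyperoperation $\boxplus$, and distinct elements $0,1\in\mathbb{H}$ such that: $(\mathbb{H},\boxplus,0)$ is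 a commutative hypergroup; $(\mathbb{H}^\times,\cdot,1)$ is an abelian group, where $\mathbb{H}^\times=\mathbb{H}\setminus\{0\}$; $a\cdot 0=0\cdot a=0$ for all $a\in\mathbb{H}$; and $a\cdot(b\boxplus c)=ab\boxplus ac$ for all $a,b,c\in\mathbb{H}$, where $a\cdot(b\boxplus c)=\{ad : d\in b\boxplus c\}$. The order of a hyperfield is its number of elements. Every field is regarded as a hyperfield via $a\boxplus b=\{a+b\}$. A hyperfield homomorphism $\phi:\mathbb{H}_1\to\mathbb{H}_2$ is a map with $\phi(0)=0$, $\phi(1)=1$, $\phi(ab)=\phi(a)\phi(b)$ and $\phi(a\boxplus_1 b)\subseteq\phi(a)\boxplus_2\phi(b)$ for all $a,b\in\mathbb{H}_1$. An isomorphism of hyperfields is a homomorphism that has an inverse homomorphism. For a field $F$ and a subgroup $G$ of $F^\times$, the quotient hyperfield $F/G$ is the multiplicative monoid $(F^\times/G)\cup\{0\}$ with hyperaddition $[a]\boxplus[b]=\{[c] : c=a'+b' \text{ for some } a'\in[a],\ b'\in[b]\}$, where $[a]=aG$ denotes the class of $a$ (and $[0]=\{0\}$). A hyperfield (or its isomorphism class) is a quotient of a field $F$ if it is isomorphic to $F/G$ for some subgroup $G$ of $F^\times$. The Krasner hyperfield is $\mathbb{K}=\{0,1\}$ with the usual multiplication and hyperaddition characterized by $1\boxplus 1=\{0,1\}$ (and $0$ as additive identity). The hyperfield of signs is $\mathbb{S}=\{0,1,-1\}$ with the usual multiplication and hyperaddition characterized by $1\boxplus 1=\{1\}$, $(-1)\boxplus(-1)=\{-1\}$,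 $1\boxplus(-1)=\{0,1,-1\}$ (and $0$ as additive identity). $\mathbb{R}_{>0}$ is the multiplicative group of positive real numbers. *)

(* Defs.v *)
From mathcomp Require Import all_boot all_order all_algebra.
From mathcomp Require Import boolp classical_sets functions cardinality reals.

Set Implicit Arguments.
Unset Strict Implicit.
Unset Printing Implicit Defensive.

Import Order.TTheory GRing.Theory Num.Theory.
Local Open Scope classical_set_scope.
Local Open Scope ring_scope.

Definition hyperop (T : Type) := T -> T -> set T.

(* [opp] is carried as data, pinned down by the uniqueness clause
   [hyperoppP]. *)
Record is_comm_hypergroup (T : Type) (add : hyperop T) (zero : T)
    (opp : T -> T) : Prop := IsCommHypergroup {
  hyperadd_neq0 : forall a b, add a b !=set0;
  hyperaddA : forall a b c,
    \bigcup_(d in add b c) add a d = \bigcup_(d in add a b) add d c;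
  hyperaddC : forall a b, add a b = add b a;
  hyperadd0l : forall a, add zero a = [set a];
  hyperadd0r : forall a, add a zero = [set a];
  hyperoppP : forall a, unique (fun b => add a b zero) (opp a);
  hyperadd_rev : forall a b c, add b c a <-> add (opp a) c (opp b)
}.

Record is_abelian_group_on (T : Type) (U : set T) (mul : T -> T -> T) (one : T)
    : Prop := IsAbelianGroupOn {
  ago_one : U one;
  ago_closed : forall a b, U a -> U b -> U (mul a b);
  agoA : forall a b c, U a -> U b -> U c -> mul a (mul b c) = mul (mul a b) c;
  agoC : forall a b, U a -> U b -> mul a b = mul b a;
  ago1 : forall a, U a -> mul one a = a;
  agoV : forall a, U a -> exists2 b, U b & mul b a = one
}.

Record hyperfield := Hyperfield {
  hcarrier :> Type;
  hzero : hcarrier;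
  hone : hcarrier;
  hopp : hcarrier -> hcarrier;
  hadd : hyperop hcarrier;
  hmul : hcarrier -> hcarrier -> hcarrier;
  hone_neq0 : hone <> hzero;
  hadd_hypergroup : is_comm_hypergroup hadd hzero hopp;
  hmul_group : is_abelian_group_on [set a | a <> hzero] hmul hone;
  hmul0l : forall a, hmul hzero a = hzero;
  hmul0r : forall a, hmul a hzero = hzero;
  hmul_addr : forall a b c,
    [set hmul a d | d in hadd b c] = hadd (hmul a b) (hmul a c)
}.

Arguments hzero {_}.
Arguments hone {_}.

Definition has_order (H : hyperfield) (n : nat) : Prop := ([set: H] #= `I_n)%card.

Record is_hyperfield_hom (H1 H2 : hyperfield) (phi : H1 -> H2) : Prop :=
  IsHyperfieldHom {
  hhom0 : phi hzero = hzero;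
  hhom1 : phi hone = hone;
  hhomM : forall a b, phi (hmul a b) = hmul (phi a) (phi b);
  hhomD : forall a b, phi @` hadd a b `<=` hadd (phi a) (phi b)
}.

Definition hyperfield_iso (H1 H2 : hyperfield) : Prop :=
  exists (phi : H1 -> H2) (psi : H2 -> H1),
    [/\ is_hyperfield_hom phi, is_hyperfield_hom psi,
        cancel phi psi & cancel psi phi].

Definition num_iso_classes (P : hyperfield -> Prop) (n : nat) : Prop :=
  exists h : 'I_n -> hyperfield,
    [/\ forall i, P (h i),
        forall i j, hyperfield_iso (h i) (h j) -> i = j &
        forall H, P H -> exists i, hyperfield_iso H (h i)].

Section FieldAsHyperfield.
Variable F : fieldType.

Let fadd (a b : F) : set F := [set a + b].

Lemma field_comm_hypergroup : is_comm_hypergroup fadd 0 (-%R).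
Proof.
rewrite /fadd; split => [a b|a b c|a b|a|a|a|a b c].
- by exists (a + b).
- by rewrite !bigcup_set1 addrA.
- by rewrite addrC.
- by rewrite add0r.
- by rewrite addr0.
- split=> [|b] /=; first by rewrite subrr.
  by move/esym/eqP; rewrite addrC addr_eq0 => /eqP ->.
- split=> /= [->|e]; first by rewrite opprD -addrA addNr addr0.
  by rewrite -[b]opprK e opprD opprK -addrA addNr addr0.
Qed.

Lemma field_mul_group : is_abelian_group_on [set a : F | a <> 0] *%R 1.
Proof.
split=> /= [|a b /eqP a0 /eqP b0|a b c _ _ _|a b _ _|a _|a /eqP a0].
- exact/eqP/oner_neq0.
- by apply/eqP; rewrite mulf_neq0.
- exact: mulrA.
- exact: mulrC.
- exact: mul1r.
- by exists a^-1; [apply/eqP; rewrite invr_eq0|rewrite mulVf].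
Qed.

Lemma field_mul_addr (a b c : F) :
  [set a * d | d in fadd b c] = fadd (a * b) (a * c).
Proof. by rewrite image_set1 mulrDr. Qed.

Definition field_hyperfield : hyperfield :=
  Hyperfield (elimN eqP (oner_neq0 F)) field_comm_hypergroup field_mul_group
    (@mul0r F) (@mulr0 F) field_mul_addr.

End FieldAsHyperfield.

Record unit_subgroup (F : fieldType) := UnitSubgroup {
  usubg :> set F;
  usubg0 : ~ usubg 0;
  usubg1 : usubg 1;
  usubgM : forall x y, usubg x -> usubg y -> usubg (x * y);
  usubgV : forall x, usubg x -> usubg x^-1
}.

Section QuotientHyperfield.
Variables (F : fieldType) (G : unit_subgroup F).

(* The class aG; for a = 0 this is {0}, so the set of all classes is the
   disjoint union of F^*/G and {[0]}. *)
Definition qclass_set (a : F) : set F := [set a * g | g in G].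

Definition quot_carrier := {A : set F | range qclass_set A}.

Definition qclass (a : F) : quot_carrier :=
  exist _ (qclass_set a) (imageT qclass_set a).

Lemma quot_val_inj (A B : quot_carrier) : sval A = sval B -> A = B.
Proof.
case: A B => [A hA] [B hB] /= e; subst B.
by rewrite (Prop_irrelevance hA hB).
Qed.

Lemma quotP (A : quot_carrier) : exists a, A = qclass a.
Proof. by case: (svalP A) => a _ e; exists a; apply: quot_val_inj. Qed.

Lemma qclass_refl a : sval (qclass a) a.
Proof. by exists 1; [exact: usubg1|rewrite mulr1]. Qed.

Lemma usubg_neq0 g : usubg G g -> g != 0.
Proof. by move=> Gg; apply/eqP => g0; apply: (@usubg0 _ G); rewrite -g0. Qed.

Lemma qclass_mulg a g : usubg G g -> qclass (a * g) = qclass a.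
Proof.
move=> Gg; apply: quot_val_inj; apply/seteqP; split=> _ /= [h Gh <-].
  by exists (g * h); [exact: usubgM|rewrite mulrA].
exists (g^-1 * h); first by apply: usubgM => //; exact: usubgV.
by rewrite -mulrA mulVKf // usubg_neq0.
Qed.

Lemma qclass_mem a b : sval (qclass a) b -> qclass b = qclass a.
Proof. by case=> g Gg <-; exact: qclass_mulg. Qed.

Lemma qclass_eq a b : qclass a = qclass b -> exists2 g, usubg G g & a = b * g.
Proof. by move=> e; have := qclass_refl a; rewrite e => -[g Gg <-]; exists g. Qed.

Lemma qclass_eq0 a : qclass a = qclass 0 -> a = 0.
Proof. by move/qclass_eq => [g _]; rewrite mul0r. Qed.

Lemma quot_mul_subproof (A B : quot_carrier) :
  range qclass_set [set x * y | x in sval A & y in sval B].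
Proof.
have [a ->] := quotP A; have [b ->] := quotP B.
exists (a * b) => //; apply/seteqP; split=> [_ [g Gg <-]|] /=.
  exists (a * g); first by exists g.
  by exists b; [exact: qclass_refl|rewrite mulrAC].
move=> _ [_ [g Gg <-] [_ [h Gh <-] <-]].
by exists (g * h); [exact: usubgM|rewrite mulrACA].
Qed.

Definition quot_mul (A B : quot_carrier) : quot_carrier :=
  exist _ _ (quot_mul_subproof A B).

Lemma quot_mulE a b : quot_mul (qclass a) (qclass b) = qclass (a * b).
Proof.
apply: quot_val_inj; apply/seteqP; split=> [|_ [g Gg <-]] /=.
  move=> _ [_ [g Gg <-] [_ [h Gh <-] <-]].
  by exists (g * h); [exact: usubgM|rewrite mulrACA].
exists (a * g); first by exists g.
by exists b; [exact: qclass_refl|rewrite mulrAC].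
Qed.

Lemma quot_opp_subproof (A : quot_carrier) :
  range qclass_set [set - x | x in sval A].
Proof.
have [a ->] := quotP A; exists (- a) => //.
apply/seteqP; split=> [_ [g Gg <-]|_ [_ [g Gg <-] <-]].
  by exists (a * g); [exists g|rewrite mulNr].
by exists g => //; rewrite mulNr.
Qed.

Definition quot_opp (A : quot_carrier) : quot_carrier :=
  exist _ _ (quot_opp_subproof A).

Lemma quot_oppE a : quot_opp (qclass a) = qclass (- a).
Proof.
apply: quot_val_inj; apply/seteqP; split=> [_ [_ [g Gg <-] <-]|_ [g Gg <-]].
  by exists g => //; rewrite mulNr.
by exists (a * g); [exists g|rewrite mulNr].
Qed.

Definition quot_add : hyperop quot_carrier := fun A B =>
  [set qclass (x + y) | x in sval A & y in sval B].

Lemma quot_addP a b c : quot_add (qclass a) (qclass b) (qclass c) <->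
  exists g h, [/\ usubg G g, usubg G h & c = a * g + b * h].
Proof.
split=> [[_ [g Gg <-] [_ [h Gh <-] /esym/qclass_eq[k Gk ->]]]|].
  exists (g * k), (h * k).
  by split; [exact: usubgM|exact: usubgM|rewrite mulrDl !mulrA].
move=> [g [h [Gg Gh ->]]]; exists (a * g); first by exists g.
by exists (b * h) => //; exists h.
Qed.

Lemma quot_addC A B : quot_add A B = quot_add B A.
Proof.
by apply/seteqP; split=> _ [x Ax [y By <-]]; exists y => //; exists x => //;
  rewrite addrC.
Qed.

Lemma quot_add0l A : quot_add (qclass 0) A = [set A].
Proof.
have [a ->] := quotP A; apply/seteqP; split=> [C|_ ->] /=.
  have [c ->] := quotP C => /quot_addP[g [h [_ Gh ->]]].
  by rewrite mul0r add0r qclass_mulg.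
by apply/quot_addP; exists 1, 1; rewrite mul0r add0r mulr1; split=> //;
  exact: usubg1.
Qed.

Lemma quot_addA A B C :
  \bigcup_(D in quot_add B C) quot_add A D =
  \bigcup_(D in quot_add A B) quot_add D C.
Proof.
have [a ->] := quotP A; have [b ->] := quotP B; have [c ->] := quotP C.
apply/seteqP; split=> E [D]; have [d ->] := quotP D; have [e ->] := quotP E.
  move=> /quot_addP[g [h [Gg Gh ->]]] /quot_addP[k [l [Gk Gl ->]]].
  exists (qclass (a * k + b * (g * l))).
    by apply/quot_addP; exists k, (g * l); split=> //; exact: usubgM.
  apply/quot_addP; exists 1, (h * l).
  split; [exact: usubg1|exact: usubgM|].
  by rewrite mulr1 mulrDl -!addrA !mulrA.
move=> /quot_addP[g [h [Gg Gh ->]]] /quot_addP[k [l [Gk Gl ->]]].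
exists (qclass (b * (h * k) + c * l)).
  by apply/quot_addP; exists (h * k), l; split=> //; exact: usubgM.
apply/quot_addP; exists (g * k), 1.
split; [exact: usubgM|exact: usubg1|].
by rewrite mulr1 mulrDl -!addrA !mulrA.
Qed.

Lemma quot_opp_unique A : unique (fun B => quot_add A B (qclass 0)) (quot_opp A).
Proof.
have [a ->] := quotP A; rewrite quot_oppE; split.
  apply/quot_addP; exists 1, 1.
  by rewrite !mulr1 subrr; split=> //; exact: usubg1.
move=> B; have [b ->] := quotP B => /quot_addP[g [h [Gg Gh]]].
move=> /esym/eqP; rewrite addr_eq0 -mulNr => /eqP e.
rewrite -(qclass_mulg b Gh) -[in RHS](opprK (b * h)) -mulNr -e.
by rewrite -mulNr qclass_mulg.
Qed.

Lemma quot_add_rev1 A B C :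
  quot_add B C A -> quot_add (quot_opp A) C (quot_opp B).
Proof.
have [a ->] := quotP A; have [b ->] := quotP B; have [c ->] := quotP C.
rewrite !quot_oppE => /quot_addP[g [h [Gg Gh ->]]].
apply/quot_addP; exists g^-1, (h * g^-1); split; [exact: usubgV| |].
  by apply: usubgM => //; exact: usubgV.
by rewrite mulrA -mulrDl opprD subrK -mulNr mulfK // usubg_neq0.
Qed.

Lemma quot_oppK A : quot_opp (quot_opp A) = A.
Proof. by have [a ->] := quotP A; rewrite !quot_oppE opprK. Qed.

Lemma quot_comm_hypergroup : is_comm_hypergroup quot_add (qclass 0) quot_opp.
Proof.
split.
- move=> A B; have [a ->] := quotP A; have [b ->] := quotP B.
  exists (qclass (a + b)), a; first exact: qclass_refl.
  by exists b => //; exact: qclass_refl.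
- exact: quot_addA.
- exact: quot_addC.
- exact: quot_add0l.
- by move=> A; rewrite quot_addC quot_add0l.
- exact: quot_opp_unique.
- move=> A B C; split; first exact: quot_add_rev1.
  by move/quot_add_rev1; rewrite !quot_oppK.
Qed.

Lemma quot_one_neq0 : qclass 1 <> qclass 0.
Proof. by move/qclass_eq0/eqP; rewrite oner_eq0. Qed.

Lemma quot_mul_group :
  is_abelian_group_on [set A | A <> qclass 0] quot_mul (qclass 1).
Proof.
have nz a : qclass a <> qclass 0 -> a != 0.
  by move=> a0; apply/eqP => e; apply: a0; rewrite e.
split=> /=.
- exact: quot_one_neq0.
- move=> A B; have [a ->] := quotP A; have [b ->] := quotP B => /nz a0 /nz b0.
  by rewrite quot_mulE => /qclass_eq0/eqP; rewrite mulf_eq0 (negPf a0) (negPf b0).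
- move=> A B C _ _ _.
  have [a ->] := quotP A; have [b ->] := quotP B; have [c ->] := quotP C.
  by rewrite !quot_mulE mulrA.
- move=> A B _ _; have [a ->] := quotP A; have [b ->] := quotP B.
  by rewrite !quot_mulE mulrC.
- by move=> A _; have [a ->] := quotP A; rewrite quot_mulE mul1r.
- move=> A; have [a ->] := quotP A => /nz a0; exists (qclass a^-1).
    by move/qclass_eq0/eqP; rewrite invr_eq0 (negPf a0).
  by rewrite quot_mulE mulVf.
Qed.

Lemma quot_mul0l A : quot_mul (qclass 0) A = qclass 0.
Proof. by have [a ->] := quotP A; rewrite quot_mulE mul0r. Qed.

Lemma quot_mul0r A : quot_mul A (qclass 0) = qclass 0.
Proof. by have [a ->] := quotP A; rewrite quot_mulE mulr0. Qed.

Lemma quot_mul_addr A B C :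
  [set quot_mul A D | D in quot_add B C] =
  quot_add (quot_mul A B) (quot_mul A C).
Proof.
have [a ->] := quotP A; have [b ->] := quotP B; have [c ->] := quotP C.
rewrite !quot_mulE; apply/seteqP; split=> [_ [D + <-]|E].
  have [d ->] := quotP D => /quot_addP[g [h [Gg Gh ->]]].
  by rewrite quot_mulE; apply/quot_addP; exists g, h; rewrite mulrDr !mulrA.
have [e ->] := quotP E => /quot_addP[g [h [Gg Gh ->]]].
exists (qclass (b * g + c * h)); first by apply/quot_addP; exists g, h.
by rewrite quot_mulE mulrDr !mulrA.
Qed.

Definition quotient_hyperfield : hyperfield :=
  Hyperfield quot_one_neq0 quot_comm_hypergroup quot_mul_group
    quot_mul0l quot_mul0r quot_mul_addr.

End QuotientHyperfield.

Definition is_quotient_of (H : hyperfield) (F : fieldType) : Prop :=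
  exists G : unit_subgroup F, hyperfield_iso H (quotient_hyperfield G).

Definition quotient_of_field (H : hyperfield) : Prop :=
  exists F : fieldType, is_quotient_of H F.

Definition quotient_of_finite_field (H : hyperfield) : Prop :=
  exists F : finFieldType, is_quotient_of H F.

Definition quotient_of_infinite_field (H : hyperfield) : Prop :=
  exists2 F : fieldType, infinite_set [set: F] & is_quotient_of H F.

Section PositiveReals.
Variable R : realType.

Definition pos_reals : unit_subgroup R.
Proof.
apply: (@UnitSubgroup R [set x | 0 < x]) => /=.
- by rewrite ltxx.
- exact: ltr01.
- exact: mulr_gt0.
- by move=> x; rewrite invr_gt0.
Defined.

End PositiveReals.

(* The Krasner hyperfield on {0, 1} = {false, true}. *)
Definition krasner_add (a b : bool) : set bool :=
  match a, b with
  | false, x | x, false => [set x]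
  | true, true => setT
  end.

Lemma krasner_comm_hypergroup : is_comm_hypergroup krasner_add false id.
Proof.
split.
- by move=> [] []; [exists true|exists true|exists true|exists false].
- move=> a b c; apply/seteqP; split=> x [d]; case: a b c x d => [] [] [] [] [];
    rewrite /krasner_add //= => h1 h2; try (by exists true); by exists false.
- by move=> [] [].
- by case.
- by case.
- by move=> []; split=> // -[].
- by move=> [] [] []; rewrite /krasner_add.
Qed.

Lemma krasner_mul_group : is_abelian_group_on [set a | a <> false] andb true.
Proof.
split=> //=; first by move=> [] [].
- by move=> [] [] [].
- by move=> [] [].
- by move=> [] // _; exists true.
Qed.

Lemma krasner_mul_addr (a b c : bool) :
  [set a && d | d in krasner_add b c] = krasner_add (a && b) (a && c).
Proof.
apply/seteqP; split=> x /=; rewrite /krasner_add.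
  by case=> d; case: a b c x d => [] [] [] [] [].
by case: a b c x => [] [] [] [] //=; by [exists true|exists false].
Qed.

Definition krasner : hyperfield :=
  @Hyperfield bool false true id krasner_add andb (fun e => notF (esym e))
    krasner_comm_hypergroup krasner_mul_group andFb andbF krasner_mul_addr.

Inductive sign3 : Type := SZero | SPos | SNeg.

Definition sign_opp (a : sign3) : sign3 :=
  match a with SZero => SZero | SPos => SNeg | SNeg => SPos end.

Definition sign_mul (a b : sign3) : sign3 :=
  match a, b with
  | SZero, _ | _, SZero => SZero
  | SPos, x | x, SPos => x
  | SNeg, SNeg => SPos
  end.

Definition sign_add (a b : sign3) : set sign3 :=
  match a, b with
  | SZero, x | x, SZero => [set x]
  | SPos, SPos => [set SPos]
  | SNeg, SNeg => [set SNeg]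
  | SPos, SNeg | SNeg, SPos => setT
  end.

Lemma sign_comm_hypergroup : is_comm_hypergroup sign_add SZero sign_opp.
Proof.
split.
- by move=> [] []; rewrite /sign_add;
    by [exists SZero|exists SPos|exists SNeg].
- move=> a b c; apply/seteqP; split=> x [d]; case: a b c x d => [] [] [] [] [];
    rewrite /sign_add //= => h1 h2;
    by [exists SZero|exists SPos|exists SNeg].
- by move=> [] [].
- by case.
- by case.
- by move=> []; split=> // -[].
- by move=> [] [] []; rewrite /sign_add.
Qed.

Lemma sign_mul_group : is_abelian_group_on [set a | a <> SZero] sign_mul SPos.
Proof.
split=> //=; first by move=> [] [].
- by move=> [] [] [].
- by move=> [] [].
- by case.
- by move=> [] // _; by [exists SPos|exists SNeg].
Qed.

Lemma sign_mul0r a : sign_mul a SZero = SZero. Proof. by case: a. Qed.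

Lemma sign_mul_addr (a b c : sign3) :
  [set sign_mul a d | d in sign_add b c] =
  sign_add (sign_mul a b) (sign_mul a c).
Proof.
apply/seteqP; split=> x /=; rewrite /sign_add.
  by case=> d; case: a b c x d => [] [] [] [] [].
by case: a b c x => [] [] [] [] //=;
  by [exists SZero|exists SPos|exists SNeg].
Qed.

Lemma sign_one_neq0 : SPos <> SZero. Proof. by []. Qed.

Definition signs : hyperfield :=
  @Hyperfield sign3 SZero SPos sign_opp sign_add sign_mul sign_one_neq0
    sign_comm_hypergroup sign_mul_group (fun=> erefl) sign_mul0r sign_mul_addr.

(* Main.v *)
(** A group with at most three elements is cyclic, so the multiplication of a
    hyperfield of order at most 4 is determined by its order, and by
    distributivity the hyperaddition is determined by the sums 1 + y with
    y <> 0: a table of m (m + 1) bits when the order is m + 1. All the tables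
    are enumerated, tested against the axioms and compared up to isomorphism by
    computation. Such a hyperfield is a quotient of F exactly when its table is
    realised by a multiplicative surjection F -> H. In order 4 let g be a
    generator of the units and G, gG, g^2G the cosets in F.
    - Four tables are those of F_4 and of the quotients of F_7, F_13 and F_19 by
      their nonzero cubes.
    - The table with 1 + 1 = H and 1 + g = {1, g} comes from the 2-adic valuation
      modulo 3 on the rationals. In a finite field, G + gG always meets g^2G:
      otherwise y |-> y - 1 or y^-1 - 1 would inject gG into G minus -1.
    - Algebraic identities between a few well chosen elements exclude the two
      remaining tables. *)

Require Import Defs.
From mathcomp Require Import all_boot all_order all_algebra.
From mathcomp Require Import finfield.
From mathcomp Require Import boolp classical_sets functions cardinality reals.
From mathcomp Require Import zify ring.

Set Implicit Arguments.
Unset Strict Implicit.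
Unset Printing Implicit Defensive.

Import Order.TTheory GRing.Theory Num.Theory.

(** * Arithmetic of codes and tables *)

(* In a cyclic group of order [m] generated by [g] with a zero adjoined, [0] has
   code 0 and [g ^ k] has code [k + 1]. *)
Definition mulc (m a b : nat) : nat :=
  if (a == 0) || (b == 0) then 0 else ((a.-1 + b.-1) %% m).+1.

(** The quotient [b / a] for [a] nonzero. The exponent of [a] is subtracted from [m] first, so that
    truncated subtraction does no harm modulo [m]. *)
Definition divc (m b a : nat) : nat :=
  if b == 0 then 0 else ((b.-1 + (m - a.-1)) %% m).+1.

(* The bit [i * (m + 1) + k] of [r] tells whether the element of code [k] is in
   [1 + g ^ i]. *)
Definition addc (m : nat) (r : seq bool) (a b c : nat) : bool :=
  if a == 0 then c == b else if b == 0 then c == a else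
  nth false r ((divc m b a).-1 * m.+1 + divc m c a).

(** If no code fits, [find] returns [m + 1], which [valid_add] rejects as out of range. *)
Definition oppc (m : nat) (r : seq bool) (a : nat) : nat :=
  find (fun b => addc m r a b 0) (iota 0 m.+1).

Definition all_code (m : nat) (P : pred nat) : bool := all P (iota 0 m.+1).
Definition has_code (m : nat) (P : pred nat) : bool := has P (iota 0 m.+1).

Lemma all_codeP m (P : pred nat) :
  reflect (forall k, k < m.+1 -> P k) (all_code m P).
Proof.
apply: (iffP allP) => h k; first by move=> km; apply: h; rewrite mem_iota.
by rewrite mem_iota => /andP[_]; apply: h.
Qed.

Lemma has_codeP m (P : pred nat) :
  reflect (exists2 k, k < m.+1 & P k) (has_code m P).
Proof.
apply: (iffP hasP) => -[k]; first by rewrite mem_iota => /andP[_]; exists k.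
by move=> km Pk; exists k => //; rewrite mem_iota.
Qed.

Definition valid_mul (m : nat) : bool :=
  [&& all_code m (fun a => mulc m 1 a == a),
      all_code m (fun a => (a != 0) ==>
        has_code m (fun b => (b != 0) && (mulc m b a == 1))),
      all_code m (fun a => all_code m (fun b =>
        [&& mulc m a b < m.+1, mulc m a b == mulc m b a &
            (a != 0) && (b != 0) ==> (mulc m a b != 0)])) &
      all_code m (fun a => all_code m (fun b => all_code m (fun c =>
        mulc m a (mulc m b c) == mulc m (mulc m a b) c)))].

(* [vm_compute] evaluates both arguments of [&&]; the conditionals here and in
   [recodes] spare it the costly tests once a cheap one has failed. *)
Definition valid_add (m : nat) (r : seq bool) : bool :=
  if [&& all_code m (fun a => (oppc m r a < m.+1) && addc m r a (oppc m r a) 0),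
      all_code m (fun a => all_code m (fun b =>
        [&& has_code m (addc m r a b),
            all_code m (fun c => addc m r a b c == addc m r b a c) &
            addc m r a b 0 ==> (b == oppc m r a)])) &
      all_code m (fun a => all_code m (fun b => all_code m (fun c =>
        addc m r b c a == addc m r (oppc m r a) c (oppc m r b))))]
  then
     all_code m (fun a => all_code m (fun b => all_code m (fun c =>
        all_code m (fun x =>
          has_code m (fun d => addc m r b c d && addc m r a d x) ==
          has_code m (fun d => addc m r a b d && addc m r d c x))))) &&
     all_code m (fun a => all_code m (fun b => all_code m (fun c =>
        all_code m (fun x =>
          has_code m (fun d => addc m r b c d && (mulc m a d == x)) ==
          addc m r (mulc m a b) (mulc m a c) x))))
  else false.

Definition valid (m : nat) (r : seq bool) : bool :=
  [&& 0 < m, valid_mul m & valid_add m r].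

(** * Multiplication in a hyperfield and codings by tables *)

Lemma hmulC (H : hyperfield) (x y : H) : hmul x y = hmul y x.
Proof.
have [->|x0] := pselect (x = hzero); first by rewrite hmul0l hmul0r.
have [->|y0] := pselect (y = hzero); first by rewrite hmul0l hmul0r.
exact: agoC (hmul_group H) _ _ x0 y0.
Qed.

Lemma hmulA (H : hyperfield) (x y z : H) :
  hmul x (hmul y z) = hmul (hmul x y) z.
Proof.
have [->|x0] := pselect (x = hzero); first by rewrite !hmul0l.
have [->|y0] := pselect (y = hzero); first by rewrite ?(hmul0l, hmul0r).
have [->|z0] := pselect (z = hzero); first by rewrite !hmul0r.
exact: agoA (hmul_group H) _ _ _ x0 y0 z0.
Qed.

Lemma hmul1 (H : hyperfield) (x : H) : hmul hone x = x.
Proof.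
have [->|x0] := pselect (x = hzero); first by rewrite hmul0r.
exact: ago1 (hmul_group H) _ x0.
Qed.

Lemma hmulI (H : hyperfield) (x : H) : x <> hzero -> injective (hmul x).
Proof.
move=> /(agoV (hmul_group H))[x' _ x'x] y z e.
by rewrite -[y]hmul1 -[z]hmul1 -x'x -!hmulA e.
Qed.

Lemma hmul_neq0 (H : hyperfield) (x y : H) :
  x <> hzero -> y <> hzero -> hmul x y <> hzero.
Proof. exact: (ago_closed (hmul_group H)). Qed.

Lemma hadd_scale (H : hyperfield) (x y z : H) : x <> hzero ->
  hadd (hmul x hone) (hmul x y) (hmul x z) <-> hadd hone y z.
Proof.
move=> x0; rewrite -hmul_addr; split=> [[d hd /(hmulI x0) <-] //|h].
by exists z.
Qed.

Record coded (m : nat) (r : seq bool) (H : hyperfield) (c : H -> nat) : Prop :=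
  Coded {
    code_lt : forall x, c x < m.+1;
    code_inj : injective c;
    code_surj : forall k, k < m.+1 -> exists x, c x = k;
    code0 : c hzero = 0;
    code1 : c hone = 1;
    codeM : forall x y, c (hmul x y) = mulc m (c x) (c y);
    codeD : forall x y z, hadd x y z <-> addc m r (c x) (c y) (c z)
  }.

Definition has_table (m : nat) (r : seq bool) (H : hyperfield) : Prop :=
  exists c, @coded m r H c.

(** * The hyperfield of a valid table *)

Section TableHyperfield.
Variables (m : nat) (r : seq bool).
Hypothesis r_valid : valid m r.

Let T := 'I_m.+1.
(** [inord] sends numbers out of range to 0; [mulE] and [oppE] show that validity prevents this. *)
Let mul (a b : T) : T := inord (mulc m a b).
Let add : hyperop T := fun a b => [set c : T | addc m r a b c]%classic.
Let opp (a : T) : T := inord (oppc m r a).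
Let zero : T := ord0.
Let one : T := inord 1.

Let m_gt0 : 0 < m. Proof. by case/and3P: r_valid. Qed.

Let oneE : one = 1 :> nat. Proof. by rewrite inordK. Qed.

Let all1 (P : pred nat) : all_code m P -> forall a : T, P a.
Proof. by move/all_codeP=> h a; exact: h (ltn_ord a). Qed.

Let all2 (P : nat -> pred nat) : all_code m (fun a => all_code m (P a)) ->
  forall a b : T, P a b.
Proof. by move=> h a; exact: all1 (all1 h a). Qed.

Let all3 (P : nat -> nat -> pred nat) :
  all_code m (fun a => all_code m (fun b => all_code m (P a b))) ->
  forall a b c : T, P a b c.
Proof. by move=> h a; exact: all2 (all1 h a). Qed.

Let hasE (P : pred nat) : has_code m P <-> exists d : T, P d.
Proof.
split=> [/has_codeP[k km Pk]|[d Pd]]; first by exists (Ordinal km).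
by apply/has_codeP; exists (val d) => //; exact: ltn_ord.
Qed.

Let mulE (a b : T) : mul a b = mulc m a b :> nat.
Proof.
move: r_valid; rewrite /valid /valid_mul => /and3P[_ /and4P[_ _ h _] _].
by rewrite inordK //; move: (all2 h a b) => /= /and3P [].
Qed.

Let oppE (a : T) : opp a = oppc m r a :> nat.
Proof.
move: r_valid; rewrite /valid /valid_add.
case/and3P=> _ _ /andP[/and3P[h _ _] _].
by rewrite inordK //; move: (all1 h a) => /= /andP [].
Qed.

Lemma table_comm_hypergroup : is_comm_hypergroup add zero opp.
Proof.
move: r_valid; rewrite /valid /valid_add.
case/and3P=> _ _ /andP[/and3P[hopp h2 hrev] /andP[hassoc _]].
have addC (a b : T) c : c < m.+1 -> addc m r a b c = addc m r b a c.
  by move=> cm; move: (all2 h2 a b) => /= /and3P [] _ /all_codeP/(_ _ cm)/eqP.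
have hC (a b : T) : add a b = add b a.
  by apply/seteqP; split=> c; rewrite /add /= addC.
have h0 (a : T) : add zero a = [set a]%classic.
  apply/seteqP; split=> c; rewrite /add /= /addc /=; last by move->.
  by move/eqP/val_inj.
split.
- by move=> a b; move: (all2 h2 a b) => /= /and3P [] /hasE[d ?] _ _; exists d.
- move=> a b c; apply/seteqP; split=> x [d /= hd hx].
    have /eqP e := all1 (all3 hassoc a b c) x.
    have /hasE[d' /andP[? ?]] :
        has_code m (fun d => addc m r a b d && addc m r d c x).
      by rewrite -e; apply/hasE; exists d; apply/andP.
    by exists d'.
  have /eqP e := all1 (all3 hassoc a b c) x.
  have /hasE[d' /andP[? ?]] :
      has_code m (fun d => addc m r b c d && addc m r a d x).
    by rewrite e; apply/hasE; exists d; apply/andP.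
  by exists d'.
- exact: hC.
- exact: h0.
- by move=> a; rewrite hC h0.
- move=> a; split.
    by rewrite /add /= oppE; move: (all1 hopp a) => /= /andP [].
  move=> b; rewrite /add /= => ab0; apply/val_inj; rewrite /= oppE.
  by move: (all2 h2 a b) => /= /and3P [] _ _ /implyP/(_ ab0)/eqP.
- by move=> a b c; rewrite /add /= !oppE (eqP (all3 hrev a b c)).
Qed.

Lemma table_mul_group :
  is_abelian_group_on [set a | a <> zero]%classic mul one.
Proof.
move: r_valid; rewrite /valid /valid_mul => /and3P[_ /and4P[h1 hV h2 h3] _].
have nz (a : T) : a <> zero <-> val a != 0.
  by split=> [/eqP|/eqP h e]; last by apply: h; rewrite e.
split=> /=.
- by apply/nz; rewrite /= oneE.
- move=> a b /nz a0 /nz b0; apply/nz; rewrite /= mulE.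
  by move: (all2 h2 a b) => /= /and3P [] _ _ /implyP; apply; rewrite a0.
- by move=> a b c _ _ _; apply/val_inj; rewrite /= !mulE (eqP (all3 h3 a b c)).
- move=> a b _ _; apply/val_inj; rewrite /= !mulE.
  by move: (all2 h2 a b) => /= /and3P [] _ /eqP.
- by move=> a _; apply/val_inj; rewrite /= mulE oneE (eqP (all1 h1 a)).
- move=> a /nz a0.
  have /hasE[b /andP[b0 /eqP ba]] := implyP (all1 hV a) a0.
  by exists b; [exact/nz|apply/val_inj; rewrite /= mulE ba oneE].
Qed.

Lemma table_mul_addr (a b c : T) :
  [set mul a d | d in add b c]%classic = add (mul a b) (mul a c).
Proof.
move: r_valid; rewrite /valid /valid_add.
case/and3P=> _ _ /andP[_ /andP[_ hdist]].
apply/seteqP; split=> x.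
  move=> [d hd <-]; rewrite /add /=.
  have /= /eqP := all1 (all3 hdist a b c) (mul a d); rewrite !mulE => <-.
  by apply/hasE; exists d; rewrite eqxx andbT.
have /eqP e := all1 (all3 hdist a b c) x; rewrite /add /= !mulE -e.
case/hasE=> d /andP[hd /eqP ad]; exists d => //.
by apply/val_inj; rewrite /= mulE.
Qed.

Lemma ex_has_table : exists H, has_table m r H.
Proof.
have one0 : one <> zero by move/(congr1 val); rewrite /= oneE.
have mul0l a : mul zero a = zero by apply/val_inj; rewrite /= mulE.
have mul0r a : mul a zero = zero.
  by apply/val_inj; rewrite /= mulE /mulc orbT.
exists (Hyperfield one0 table_comm_hypergroup table_mul_group mul0l mul0r
  table_mul_addr), val; split=> //=.
- exact: val_inj.
- by move=> k km; exists (Ordinal km).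
Qed.

End TableHyperfield.

(** * Validity of the table of a hyperfield *)

Section CodedValid.
Variables (m : nat) (r : seq bool) (H : hyperfield) (c : H -> nat).
Hypothesis hc : coded m r c.

Let allH (P : pred nat) : (forall x, P (c x)) -> all_code m P.
Proof. by move=> h; apply/all_codeP => k /(code_surj hc)[x <-]. Qed.

Let hasH (P : pred nat) : has_code m P <-> exists x, P (c x).
Proof.
split=> [/has_codeP[k /(code_surj hc)[x <-]]|[x Px]]; first by exists x.
by apply/has_codeP; exists (c x) => //; exact: code_lt hc x.
Qed.

Lemma code_eq0 x : (c x == 0) <-> x = hzero.
Proof.
split=> [/eqP|->]; last by rewrite (code0 hc).
by rewrite -(code0 hc) => /(code_inj hc).
Qed.

Lemma hadd0P (x y : H) : hadd x y hzero <-> y = hopp x.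
Proof.
have [h1 h2] := hyperoppP (hadd_hypergroup H) x.
by split=> [/h2|->].
Qed.

(** [find] stops at the code of some [y] with 0 in [x + y], and the opposite of [x] is the only such
    element. *)
Lemma code_opp x : c (hopp x) = oppc m r (c x).
Proof.
rewrite /oppc; set P := fun b => _.
have hP : has P (iota 0 m.+1).
  apply/hasP; exists (c (hopp x)); first by rewrite mem_iota /= (code_lt hc).
  by rewrite /P -(code0 hc); apply/(codeD hc)/hadd0P.
have lt : find P (iota 0 m.+1) < m.+1 by rewrite has_find size_iota in hP.
have [y yE] := code_surj hc lt.
move: (nth_find 0 hP); rewrite nth_iota // add0n -yE /P -(code0 hc).
by move/(codeD hc)/hadd0P ->.
Qed.

Lemma coded_valid : valid m r.
Proof.
have hg := hadd_hypergroup H; have hm := hmul_group H.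
have nz x : c x != 0 <-> x <> hzero.
  by rewrite -code_eq0; split=> /negP.
have biff (a b : bool) : (a <-> b) -> a == b.
  by move=> h; apply/eqP; apply/idP/idP => /h.
apply/and3P; split.
- by rewrite -ltnS -(code1 hc); exact: code_lt hc _.
- apply/and4P; split.
  + apply: allH => x; rewrite -(code1 hc) -(codeM hc); apply/eqP; congr c.
    exact: hmul1.
  + apply: allH => x; apply/implyP => /nz/(agoV hm)[y /= y0 yx].
    apply/hasH; exists y.
    by rewrite -(codeM hc) yx (code1 hc) eqxx andbT; apply/nz.
  + apply: allH => x; apply: allH => y.
    rewrite -!(codeM hc) (code_lt hc) hmulC eqxx /=.
    apply/implyP => /andP[/nz h1 /nz h2]; apply/nz.
    exact: ago_closed hm _ _ h2 h1.
  + do 3![apply: allH => ?]; rewrite -!(codeM hc); apply/eqP; congr c.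
    exact: hmulA.
- apply/andP; split; [apply/and3P; split|apply/andP; split].
  + apply: allH => x.
    by rewrite -code_opp (code_lt hc) -(code0 hc); apply/(codeD hc)/hadd0P.
  + apply: allH => x; apply: allH => y; apply/and3P; split.
    * have [z hz] := hyperadd_neq0 hg x y.
      by apply/hasH; exists z; apply/(codeD hc).
    * by apply: allH => z; apply: biff; rewrite -!(codeD hc) (hyperaddC hg).
    * apply/implyP; rewrite -(code0 hc) => /(codeD hc)/hadd0P ->.
      by rewrite code_opp.
  + do 3![apply: allH => ?]; apply: biff; rewrite -!code_opp -!(codeD hc).
    exact: hyperadd_rev hg _ _ _.
  + apply: allH => a; apply: allH => b; apply: allH => z; apply: allH => t.
    have /seteqP[h1 h2] := hyperaddA hg a b z.
    apply: biff; split=> /hasH[d /andP[/(codeD hc) hd /(codeD hc) hx]].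
      have [|d' hd' hx'] := h1 t; first by exists d.
      by apply/hasH; exists d'; apply/andP; split; apply/(codeD hc).
    have [|d' hd' hx'] := h2 t; first by exists d.
    by apply/hasH; exists d'; apply/andP; split; apply/(codeD hc).
  + apply: allH => a; apply: allH => b; apply: allH => z; apply: allH => t.
    have /seteqP[h1 h2] := hmul_addr a b z.
    apply: biff; rewrite -!(codeM hc).
    split=> [/hasH[d /andP[/(codeD hc) hd]]|/(codeD hc)/h2[d hd <-]].
      rewrite -(codeM hc) => /eqP/(code_inj hc) <-.
      by apply/(codeD hc)/h1; exists d.
    apply/hasH; exists d; rewrite -(codeM hc) eqxx andbT.
    exact/(codeD hc).
Qed.

End CodedValid.

(** * Isomorphisms, recodings and the count of classes *)

(** Elements with the same code correspond to each other, and each homomorphism law is checked on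
    codes. *)
Lemma has_table_iso m r (H H' : hyperfield) :
  has_table m r H -> has_table m r H' -> hyperfield_iso H H'.
Proof.
move=> [c hc] [c' hc'].
have [f fE] : {f : H -> H' & forall x, c' (f x) = c x}.
  apply: (@choice _ _ (fun x y => c' y = c x)) => x.
  exact: code_surj hc' _ (code_lt hc x).
have [g gE] : {g : H' -> H & forall x, c (g x) = c' x}.
  apply: (@choice _ _ (fun x y => c y = c' x)) => x.
  exact: code_surj hc _ (code_lt hc' x).
exists f, g; split.
- split=> [|||a b _ [d hd <-]].
  + by apply: (code_inj hc'); rewrite fE (code0 hc) (code0 hc').
  + by apply: (code_inj hc'); rewrite fE (code1 hc) (code1 hc').
  + by move=> a b; apply: (code_inj hc'); rewrite (codeM hc') !fE (codeM hc).
  + by apply/(codeD hc'); rewrite !fE; apply/(codeD hc).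
- split=> [|||a b _ [d hd <-]].
  + by apply: (code_inj hc); rewrite gE (code0 hc) (code0 hc').
  + by apply: (code_inj hc); rewrite gE (code1 hc) (code1 hc').
  + by move=> a b; apply: (code_inj hc); rewrite (codeM hc) !gE (codeM hc').
  + by apply/(codeD hc); rewrite !gE; apply/(codeD hc').
- by move=> x; apply: (code_inj hc); rewrite gE fE.
- by move=> x; apply: (code_inj hc'); rewrite fE gE.
Qed.

Lemma hyperfield_iso_sym (H H' : hyperfield) :
  hyperfield_iso H H' -> hyperfield_iso H' H.
Proof. by move=> [f [g [hf hg fK gK]]]; exists g, f. Qed.

Lemma iso_has_table m r (H H' : hyperfield) :
  hyperfield_iso H H' -> has_table m r H' -> has_table m r H.
Proof.
move=> [f [g [hf hg fK gK]]] [c hc]; exists (c \o f); split=> /=.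
- by move=> x; exact: code_lt hc _.
- exact: inj_comp (code_inj hc) (can_inj fK).
- by move=> k /(code_surj hc)[x <-]; exists (g x); rewrite gK.
- by rewrite (hhom0 hf) (code0 hc).
- by rewrite (hhom1 hf) (code1 hc).
- by move=> x y; rewrite (hhomM hf) (codeM hc).
- move=> x y z; split=> [h|/(codeD hc) h].
    by apply/(codeD hc)/(hhomD hf); exists z.
  (* The homomorphism [f] gives only one inclusion between sums; the other comes from its inverse
     [g]. *)
  have := @hhomD _ _ _ hg (f x) (f y) (g (f z)); rewrite !fK; apply.
  by exists (f z).
Qed.

Definition words (T : Type) (A : seq T) (k : nat) : seq (seq T) :=
  iter k (fun ws => [seq a :: w | a <- A, w <- ws]) [:: [::]].

Lemma mem_words (T : eqType) (A s : seq T) :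
  {subset s <= A} -> s \in words A (size s).
Proof.
elim: s => [|a s IHs] sA //=; apply/allpairsP; exists (a, s); split=> //.
  by apply: sA; rewrite mem_head.
by apply: IHs => x xs; apply: sA; rewrite in_cons xs orbT.
Qed.

(* [s] lists the new codes of the elements coded by 0, ..., m. *)
Definition recodes (m : nat) (r r' : seq bool) (s : seq nat) : bool :=
  let u := nth 0 s in
  if [&& uniq s, u 0 == 0 & u 1 == 1] then
    [&& size s == m.+1, all (fun k => k < m.+1) s,
        all_code m (fun k => k \in s),
        all_code m (fun a => all_code m (fun b =>
          u (mulc m a b) == mulc m (u a) (u b))) &
        all_code m (fun a => all_code m (fun b => all_code m (fun c =>
          addc m r a b c == addc m r' (u a) (u b) (u c))))]
  else false.

Definition iso_tables (m : nat) (r r' : seq bool) : bool :=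
  has (recodes m r r') (words (iota 0 m.+1) m.+1).

Lemma has_table_recode m r r' H :
  iso_tables m r r' -> has_table m r H -> has_table m r' H.
Proof.
case/hasP => s _ /andP[/and3P[su /eqP s0 /eqP s1]].
case/and5P=> /eqP ss /allP slt /all_codeP smem /all_codeP sM /all_codeP sD.
case=> c hc.
have clt x : c x < size s by rewrite ss; exact: code_lt hc x.
exists (nth 0 s \o c); split=> /=.
- by move=> x; apply: slt; rewrite mem_nth.
- move=> x y /eqP /=; rewrite nth_uniq // => /eqP; exact: code_inj hc _ _.
- move=> k /smem ks; have := ks; rewrite -index_mem ss => /(code_surj hc)[x xE].
  by exists x; rewrite xE nth_index.
- by rewrite (code0 hc).
- by rewrite (code1 hc).
- move=> x y; rewrite (codeM hc); rewrite ss in clt.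
  by have /all_codeP/(_ _ (clt y))/eqP := sM _ (clt x).
- move=> x y z; rewrite (codeD hc); rewrite ss in clt.
  have /all_codeP/(_ _ (clt y)) := sD _ (clt x).
  by move=> /all_codeP/(_ _ (clt z))/eqP ->.
Qed.

(** Two codings of [H] differ by a permutation of the codes, which [s] lists. With
    [has_table_recode], isomorphism becomes a finite search. *)
Lemma iso_tablesP m r r' H :
  has_table m r H -> has_table m r' H -> iso_tables m r r'.
Proof.
move=> [c hc] [c' hc'].
(* The bound sits inside the relation so that [choice] applies to all of [nat]; beyond [m] the value
   is an arbitrary zero. *)
have [d dE] : {d : nat -> H & forall k, k < m.+1 -> c (d k) = k}.
  apply: (@choice _ _ (fun k x => k < m.+1 -> c x = k)) => k.
  case: (ltnP k m.+1) => km; last by exists hzero.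
  by have [x] := code_surj hc km; exists x.
pose s := mkseq (c' \o d) m.+1.
have sE x : nth 0 s (c x) = c' x.
  have cx := code_lt hc x; rewrite nth_mkseq //=; congr c'.
  by apply: (code_inj hc); rewrite dE.
have ss : size s = m.+1 by rewrite size_mkseq.
have all1 (P : pred nat) : (forall x, P (c x)) -> all_code m P.
  by move=> h; apply/all_codeP => k /(code_surj hc)[x <-].
have slt : all (fun k => k < m.+1) s.
  by apply/allP => k /mapP[i _ ->]; exact: code_lt hc' _.
apply/hasP; exists s.
  rewrite -{2}ss; apply: mem_words => k /(allP slt).
  by rewrite mem_iota.
apply/andP; split; [apply/and3P; split|apply/and5P; split=> //].
- apply/mkseq_uniqP => i j; rewrite !inE => im jm /(code_inj hc') e.
  by rewrite -(dE i im) -(dE j jm) e.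
- by have := sE hzero; rewrite (code0 hc) (code0 hc') => ->.
- by have := sE hone; rewrite (code1 hc) (code1 hc') => ->.
- by rewrite ss.
- apply/all_codeP => k /(code_surj hc')[x <-].
  by rewrite -sE mem_nth // ss; exact: code_lt hc x.
- apply: (all1) => x; apply: (all1) => y.
  by rewrite -(codeM hc) !sE (codeM hc').
- do 3![apply: (all1) => ?]; rewrite !sE.
  apply/eqP; apply/idP/idP; first by move/(codeD hc)/(codeD hc').
  by move/(codeD hc')/(codeD hc).
Qed.

Lemma num_iso_classes_tables (m : nat) (L : seq (seq bool))
    (P : hyperfield -> Prop) :
  all (valid m) L -> pairwise (fun r r' => ~~ iso_tables m r r') L ->
  (forall H, P H <-> exists2 r, r \in L & has_table m r H) ->
  num_iso_classes P (size L).
Proof.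
move=> /allP Lv Lp PE.
have [h hE] : {h : 'I_(size L) -> hyperfield &
    forall i : 'I_(size L), has_table m (nth [::] L i) (h i)}.
  apply: (@choice _ _ (fun i : 'I_(size L) => has_table m (nth [::] L i))) => i.
  by apply/ex_has_table/Lv/mem_nth.
(* [pairwise] compares entries in list order only; symmetry of isomorphism handles [j < i]. *)
have no (i j : 'I_(size L)) : i < j -> ~ hyperfield_iso (h i) (h j).
  move=> ij e; have /(pairwiseP [::])/(_ (val i) (val j)) := Lp.
  move/(_ (ltn_ord i) (ltn_ord j) ij)/negP; apply.
  exact: iso_tablesP (hE i) (iso_has_table e (hE j)).
exists h; split.
- by move=> i; apply/PE; exists (nth [::] L i); [exact: mem_nth|].
- move=> i j e; apply/val_inj; case: (ltngtP (val i) (val j)) => // ij.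
    by have := no _ _ ij e.
  by have := no _ _ ij (hyperfield_iso_sym e).
- move=> H /PE[r rL Hr].
  have rlt : index r L < size L by rewrite index_mem.
  exists (Ordinal rlt); apply: (has_table_iso Hr).
  by have := hE (Ordinal rlt); rewrite /= nth_index.
Qed.

Lemma has_table_order m r H : has_table m r H -> has_order H m.+1.
Proof.
move=> [c hc]; rewrite /has_order; apply/card_set_bijP; exists c; split.
- by move=> x _; exact: code_lt hc x.
- by move=> x y _ _; exact: code_inj hc _ _.
- by move=> k /(code_surj hc)[x <-]; exists x.
Qed.

(** * Every hyperfield of order at most 4 has a table *)

Record code_bij (n : nat) (T : Type) (c : T -> nat) : Prop := CodeBij {
  cb_lt : forall x, c x < n;
  cb_inj : injective c;
  cb_surj : forall k, k < n -> exists x, c x = k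
}.

(** The new coding composes [c] with the transposition [t] of [c x] and [k]. The last clause keeps
    zero at code 0 when one is then moved to code 1. *)
Lemma code_bij_move n T (c : T -> nat) (x : T) (k : nat) :
  code_bij n c -> k < n -> exists c', [/\ code_bij n c', c' x = k &
    forall y, c y <> k -> y <> x -> c' y = c y].
Proof.
move=> [clt cinj csurj] kn.
pose t i := if i == c x then k else if i == k then c x else i.
have tK : involutive t.
  rewrite /t => i; case: (eqVneq i (c x)) => [->|ix].
    by rewrite eqxx; case: eqVneq => // ->.
  case: (eqVneq i k) => [->|ik]; first by rewrite eqxx.
  by rewrite (negPf ix) (negPf ik).
have tn i : i < n -> t i < n by rewrite /t; do 2?case: ifP.
exists (t \o c); split=> [||y yk yx].
- split=> [y|y z /(can_inj tK)/cinj //|i /tn/csurj[y yE]] /=.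
    exact: tn.
  by exists y; rewrite /= yE tK.
- by rewrite /= /t eqxx.
- rewrite /= /t; case: eqP => [/cinj //|_]; by case: eqP.
Qed.

Lemma order_code n H : has_order H n.+2 ->
  exists c : H -> nat, [/\ code_bij n.+2 c, c hzero = 0 & c hone = 1].
Proof.
move=> /card_set_bijP[c [clt cinj csurj]].
have hc : code_bij n.+2 c.
  split=> [x|x y|k]; [exact: clt|by apply: cinj; rewrite inE|].
  by move=> /csurj[x _]; exists x.
have [c1 [h1 c10 _]] := code_bij_move hzero hc (isT : 0 < n.+2).
have [c2 [h2 c21 c2E]] := code_bij_move hone h1 (isT : 1 < n.+2).
exists c2; split=> //; rewrite c2E ?c10 // => /esym; exact: hone_neq0.
Qed.

(** With at most three units, cancellation alone fixes the products: for nontrivial units, [x y] is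
    neither 0, nor [x], nor [y]. Only the squares for [m = 3] then remain open. *)
Lemma code_mul m (H : hyperfield) (c : H -> nat) : 0 < m <= 3 ->
  code_bij m.+1 c -> c hzero = 0 -> c hone = 1 ->
  forall x y, c (hmul x y) = mulc m (c x) (c y).
Proof.
move=> m3 [clt cinj csurj] c0 c1.
have c0P x : c x = 0 <-> x = hzero by rewrite -c0; split=> [/cinj|->].
have c1P x : c x = 1 <-> x = hone by rewrite -c1; split=> [/cinj|->].
have noM0 x y : c x <> 0 -> c y <> 0 -> c (hmul x y) <> 0.
  by rewrite !c0P; exact: hmul_neq0.
have noMr x y : c x <> 0 -> c y <> 1 -> c (hmul x y) <> c x.
  rewrite c0P c1P => x0 y1 /cinj e; apply: y1; apply: (hmulI x0).
  by rewrite e [RHS]hmulC hmul1.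
have noMM x y z : c x <> 0 -> c y <> c z -> c (hmul x y) <> c (hmul x z).
  by rewrite c0P => x0 yz /cinj/(hmulI x0) e; apply: yz; rewrite e.
move=> x y; have [x0|x0] := eqVneq (c x) 0.
  by rewrite x0 /mulc /= (c0P x).1 // hmul0l.
have [y0|y0] := eqVneq (c y) 0.
  by rewrite y0 /mulc orbT (c0P y).1 // hmul0r.
have [x1|/eqP x1] := eqVneq (c x) 1.
  rewrite (c1P x).1 // hmul1 c1 /mulc (negPf y0) /= modn_small ?prednK ?lt0n //.
  by have := clt y; move: y0; lia.
have [y1|/eqP y1] := eqVneq (c y) 1.
  rewrite (c1P y).1 // hmulC hmul1 c1 /mulc (negPf x0) /= addn0.
  rewrite modn_small ?prednK ?lt0n //.
  by have := clt x; move: x0; lia.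
move/eqP: x0 => x0; move/eqP: y0 => y0.
have := noM0 _ _ x0 y0; have := noMr _ _ x0 y1.
have := noMr _ _ y0 x1; rewrite [hmul y x]hmulC.
have := clt x; have := clt y; have := clt (hmul x y).
case: m m3 clt csurj => [|[|[|[|m]]]] // _ clt csurj.
- lia.
- by case: (c x) x0 x1 => [|[|[|?]]] //; case: (c y) y0 y1 => [|[|[|?]]] //;
    case: (c (hmul x y)) => [|[|[|?]]].
- case: (eqVneq (c x) (c y)) => [/cinj exy|].
    (* The nontrivial codes are 2 and 3, with sum 5, so [z] is the other nontrivial unit. Then
       [x z = 1], which leaves only [z] for [x x]. *)
    subst y; have [z zE] := csurj (5 - c x) ltac:(have := clt x; lia).
    have z0 : c z <> 0 by have := clt x; lia.
    have z1 : c z <> 1 by have := clt x; lia.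
    have xz : c x <> c z by lia.
    have := noMM _ _ _ x0 xz; have := noM0 _ _ x0 z0; have := noMr _ _ x0 z1.
    have := noMr _ _ z0 x1; rewrite [hmul z x]hmulC.
    have := clt z; have := clt (hmul x z); have := clt x.
    have m22 : mulc 3 2 2 = 3 by []. have m33 : mulc 3 3 3 = 2 by [].
    have [e|e] : c x = 2 \/ c x = 3 by have := clt x; lia.
      by rewrite e m22 in zE x0 x1 xz *; lia.
    by rewrite e m33 in zE x0 x1 xz *; lia.
  case: (c x) x0 x1 => [|[|[|[|?]]]] //; case: (c y) y0 y1 => [|[|[|[|?]]]] //;
    by case: (c (hmul x y)) => [|[|[|[|?]]]].
Qed.

Lemma mulc_divc m a b : 0 < a <= m -> b <= m -> mulc m a (divc m b a) = b.
Proof.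
move=> /andP[a0 am] bm; rewrite /mulc /divc (gtn_eqF a0) /=.
have [->|b0] := eqVneq b 0 => //=.
rewrite modnDmr; have -> : a.-1 + (b.-1 + (m - a.-1)) = b.-1 + m by lia.
by rewrite modnDr modn_small ?prednK //; lia.
Qed.

Lemma divc_lt m a b : 0 < m -> divc m b a < m.+1.
Proof.
by move=> m0; rewrite /divc; case: ifP => // _; rewrite ltnS ltn_pmod.
Qed.

(** The bits are read off the sums [1 + y]. Division by [x] brings any sum [x + y] of nonzero
    elements to this form, by [hadd_scale]. *)
Lemma ex_table m (H : hyperfield) (c : H -> nat) : 0 < m -> code_bij m.+1 c ->
  c hzero = 0 -> c hone = 1 ->
  (forall x y, c (hmul x y) = mulc m (c x) (c y)) ->
  exists2 r, size r = m * m.+1 & coded m r c.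
Proof.
move=> m0 [clt cinj csurj] c0 c1 cM.
have [d dE] : {d : nat -> H & forall k, k < m.+1 -> c (d k) = k}.
  apply: (@choice _ _ (fun k x => k < m.+1 -> c x = k)) => k.
  case: (ltnP k m.+1) => km; last by exists hzero.
  by have [x] := csurj _ km; exists x.
have dK x : d (c x) = x by apply: cinj; rewrite dE.
(* Row [i] concerns [g ^ i], whose code is [i + 1]; hence the successor. *)
pose r := mkseq (fun k =>
  `[< hadd hone (d (k %/ m.+1).+1) (d (k %% m.+1)) >]) (m * m.+1).
have rE i k : i < m -> k < m.+1 ->
    nth false r (i * m.+1 + k) = `[< hadd hone (d i.+1) (d k) >].
  move=> im km; rewrite nth_mkseq; last by nia.
  by rewrite divnMDl // divn_small // addn0 modnMDl modn_small.
exists r; first by rewrite size_mkseq.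
split=> // x y z; rewrite /addc; have hg := hadd_hypergroup H.
have c0P w : c w = 0 -> w = hzero by rewrite -c0 => /cinj.
case: eqP => [/c0P ->|x0].
  by rewrite (hyperadd0l hg); split=> [->|/eqP/cinj].
case: eqP => [/c0P ->|y0].
  by rewrite (hyperadd0r hg); split=> [->|/eqP/cinj].
have xm : 0 < c x <= m by have := clt x; lia.
have dM w : w = hmul x (d (divc m (c w) (c x))).
  apply: cinj; rewrite cM dE ?divc_lt // mulc_divc //; by have := clt w.
rewrite rE ?divc_lt //; last first.
  by rewrite /divc; case: eqP => //= _; rewrite ltn_pmod.
have -> : (divc m (c y) (c x)).-1.+1 = divc m (c y) (c x).
  by rewrite /divc; case: eqP.
have xN0 : x <> hzero by move=> e; apply: x0; rewrite e.
have := hadd_scale (d (divc m (c y) (c x))) (d (divc m (c z) (c x))) xN0.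
rewrite -!dM hmulC hmul1 => e.
by split=> [/e h|/asboolP/e //]; apply/asboolP.
Qed.

(** * Enumeration of the tables of orders 2, 3 and 4 *)

(* [L] lists each isomorphism class of hyperfields of order [m + 1] once. *)
Definition complete_tables (m : nat) (L : seq (seq bool)) : bool :=
  [&& all (valid m) L, pairwise (fun r r' => ~~ iso_tables m r r') L &
    all (fun r => has (iso_tables m r) L)
      [seq r <- words [:: false; true] (m * m.+1) | valid m r]].

(** Any table of [H] is valid, hence among those enumerated, and completeness recodes it into one of
    [L]. *)
Lemma order_tables m L H : 0 < m <= 3 -> complete_tables m L ->
  has_order H m.+1 -> exists2 r, r \in L & has_table m r H.
Proof.
move=> m3 hL; have m0 : 0 < m by case/andP: m3.
rewrite -{1}(prednK m0) => /order_code[c [hc c0 c1]]; rewrite prednK // in hc.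
have [r sr hr] := ex_table m0 hc c0 c1 (code_mul m3 hc c0 c1).
have rw : r \in words [:: false; true] (m * m.+1).
  by rewrite -sr; apply: mem_words => -[].
have /hasP[r' r'L rr'] : has (iso_tables m r) L.
  by case/and3P: hL => _ _ /allP; apply; rewrite mem_filter (coded_valid hr).
by exists r' => //; apply: (has_table_recode rr'); exists c.
Qed.

Lemma order_tablesP m L H : 0 < m <= 3 -> complete_tables m L ->
  has_order H m.+1 <-> exists2 r, r \in L & has_table m r H.
Proof.
move=> m3 hL; split=> [|[r _]]; [exact: order_tables|exact: has_table_order].
Qed.

(** Each count in the theorem is an instance: [L'] selects the listed tables whose hyperfields
    satisfy [P]. *)
Lemma num_iso_classes_order (m : nat) (L L' : seq (seq bool))
    (P : hyperfield -> Prop) : complete_tables m L -> 0 < m <= 3 ->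
  subseq L' L -> (forall H, P H -> has_order H m.+1) ->
  (forall r H, r \in L -> has_table m r H -> P H <-> r \in L') ->
  num_iso_classes P (size L').
Proof.
move=> hL m3 sL' Pm PL'; case/and3P: (hL) => /allP vL pL _.
have vL' : all (valid m) L' by apply/allP => r /(mem_subseq sL')/vL.
have pL' := subseq_pairwise sL' pL.
apply: (num_iso_classes_tables vL' pL') => H; split=> [PH|[r rL' Hr]].
  have [r rL Hr] := order_tables m3 hL (Pm H PH).
  by exists r => //; apply/(PL' r H).
by apply/(PL' r H) => //; exact: mem_subseq sL' _ rL'.
Qed.

Definition bits : seq nat -> seq bool := map (fun k => k == 1).

Definition K_table := bits [:: 1; 1].
Definition F2_table := bits [:: 1; 0].
Definition tables2 := [:: K_table; F2_table].

(* The tables of F_3, of the hyperfield of signs, and of the quotients of F_7,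
   F_5 and F_13 by their squares. *)
Definition F3_table := bits [:: 0; 0; 1; 1; 0; 0].
Definition S_table := bits [:: 0; 1; 0; 1; 1; 1].
Definition F7_squares_table := bits [:: 0; 1; 1; 1; 1; 1].
Definition F5_squares_table := bits [:: 1; 0; 1; 0; 1; 1].
Definition F13_squares_table := bits [:: 1; 1; 1; 0; 1; 1].
Definition tables3 := [:: S_table; F3_table; F7_squares_table;
  F5_squares_table; F13_squares_table].

(* In order 4 one has [-1 = 1], so that a hyperaddition is given by the triples
   with [0] in their sum. Up to scaling by [g] these are [(1, 1, 1)],
   [(1, 1, g)], [(1, 1, g^2)] and [(1, g, g^2)], tested by [a], [b], [c] and
   [d]. *)
Definition order4_table (a b c d : bool) : seq bool :=
  [:: true; a; b; c; false; b; c; d; false; c; d; b].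

Definition F4_table := order4_table false false false true.
Definition F7_cubes_table := order4_table false false true true.
Definition F13_cubes_table := order4_table false true true true.
Definition F19_cubes_table := order4_table true true true true.
Definition valuation_table := order4_table true true true false.
Definition finite_tables4 :=
  [:: F4_table; F7_cubes_table; F13_cubes_table; F19_cubes_table].
Definition nonquotient_tables4 :=
  [:: order4_table false true true false; order4_table true true false true].
Definition tables4 := finite_tables4 ++ valuation_table :: nonquotient_tables4.

Lemma tables2_complete : complete_tables 1 tables2.
Proof. by vm_compute. Qed.

Lemma tables3_complete : complete_tables 2 tables3.
Proof. by vm_compute. Qed.

Lemma tables4_complete : complete_tables 3 tables4.
Proof. by vm_compute. Qed.


(** * Quotient hyperfields as codes on a field *)

Local Open Scope ring_scope.

(* The map sending [x] to the code of its class in a quotient of [F]. *)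
Record field_code (m : nat) (r : seq bool) (F : fieldType) (f : F -> nat)
    : Prop := FieldCode {
  fcode_lt : forall x, (f x < m.+1)%N;
  fcode_surj : forall k, (k < m.+1)%N -> exists x, f x = k;
  fcode_eq0 : forall x, (f x = 0)%N <-> x = 0;
  fcode1 : f 1 = 1%N;
  fcodeM : forall x y, f (x * y) = mulc m (f x) (f y);
  fcodeD : forall x y, addc m r (f x) (f y) (f (x + y));
  fcodeD_ex : forall a b c, (a < m.+1)%N -> (b < m.+1)%N -> (c < m.+1)%N ->
    addc m r a b c -> exists x y, [/\ f x = a, f y = b & f (x + y) = c]
}.

Lemma mulc1 m k : (k < m.+1)%N -> mulc m 1 k = k.
Proof.
move=> km; rewrite /mulc /=; case: eqP => [->//|k0].
by rewrite add0n modn_small ?prednK //; lia.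
Qed.

Lemma mulcC m a b : mulc m a b = mulc m b a.
Proof. by rewrite /mulc orbC addnC. Qed.

Lemma field_code_eq m r (F : fieldType) (f : F -> nat) x y :
  field_code m r f -> f x = f y -> exists2 g, f g = 1%N & x = y * g.
Proof.
move=> hf e; have [y0|y0] := eqVneq y 0.
  exists 1; first exact: fcode1 hf.
  by rewrite y0 mul0r; apply/(fcode_eq0 hf); rewrite e y0; apply/(fcode_eq0 hf).
exists (y^-1 * x); last by rewrite mulVKf.
by rewrite (fcodeM hf) e -(fcodeM hf) mulVf // (fcode1 hf).
Qed.

(** [f] is constant on the cosets of [G] and, by [field_code_eq], separates them, so the code of a
    class is that of any representative. [fcodeD] and [fcodeD_ex] give the two directions of the
    condition on sums. *)
Lemma field_code_quotient_table m r (F : fieldType) (f : F -> nat)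
    (G : unit_subgroup F) :
  field_code m r f -> (forall x, usubg G x <-> f x = 1%N) ->
  has_table m r (quotient_hyperfield G).
Proof.
move=> hf GE.
have f0 : f 0 = 0%N by apply/(fcode_eq0 hf).
have fg a g : usubg G g -> f (a * g) = f a.
  move=> /GE g1; rewrite (fcodeM hf) g1 mulcC mulc1 //; exact: fcode_lt hf _.
have [rep repE] : {rep : quot_carrier G -> F & forall A, A = qclass G (rep A)}.
  by apply: (@choice _ _ (fun A x => A = qclass G x)) => A; exact: Defs.quotP.
have cE a : f (rep (qclass G a)) = f a.
  by have /esym/qclass_eq[g Gg ->] := repE (qclass G a); rewrite fg.
have qeq x y : f x = f y -> qclass G x = qclass G y.
  by move=> /(field_code_eq hf)[g /GE Gg ->]; exact: qclass_mulg.
exists (f \o rep); split => /=.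
- by move=> A; exact: fcode_lt hf _.
- by move=> A B /qeq; rewrite -!repE.
- by move=> k /(fcode_surj hf)[x <-]; exists (qclass G x); rewrite cE.
- by rewrite cE.
- by rewrite cE (fcode1 hf).
- move=> A B; rewrite {1}[A]repE {1}[B]repE quot_mulE cE.
  exact: fcodeM hf _ _.
- move=> A B C; rewrite {1}[A]repE {1}[B]repE {1}[C]repE; split.
    move=> /quot_addP[g [h [Gg Gh ->]]].
    rewrite -(fg _ _ Gg) -(fg (rep B) _ Gh); exact: fcodeD hf _ _.
  move=> /(fcodeD_ex hf (fcode_lt hf _) (fcode_lt hf _) (fcode_lt hf _)).
  move=> [x [y [/(field_code_eq hf)[g g1 ->] /(field_code_eq hf)[h h1 ->]]]].
  move=> /esym/(field_code_eq hf)[k k1 ->]; apply/quot_addP.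
  exists (g * k), (h * k); rewrite mulrDl !mulrA; split=> //;
    by apply: usubgM; apply/GE.
Qed.

Lemma field_code_quotient m r (F : fieldType) (f : F -> nat) H :
  field_code m r f -> has_table m r H -> is_quotient_of H F.
Proof.
move=> hf Hr.
have f0 : f 0 = 0%N by apply/(fcode_eq0 hf).
have G0 : ~ [set x | f x = 1%N]%classic 0 by rewrite /= f0.
have GM x y : f x = 1%N -> f y = 1%N -> f (x * y) = 1%N.
  move=> x1 y1; rewrite (fcodeM hf) x1 mulc1 // y1.
  by rewrite -(fcode1 hf); exact: fcode_lt hf _.
have GV x : f x = 1%N -> f x^-1 = 1%N.
  move=> x1; rewrite -[LHS](@mulc1 m); last exact: fcode_lt hf _.
  rewrite -x1 -(fcodeM hf) mulfV ?x1 ?(fcode1 hf) //.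
  by apply/eqP => x0; move: x1; rewrite x0 f0.
exists (@UnitSubgroup F [set x | f x = 1%N]%classic G0 (fcode1 hf) GM GV).
exact: has_table_iso Hr (field_code_quotient_table hf _).
Qed.

(** This converse is the starting point of all the proofs that a table is not a quotient. *)
Lemma quotient_field_code m r (F : fieldType) H :
  has_table m r H -> is_quotient_of H F ->
  exists f : F -> nat, field_code m r f.
Proof.
move=> Hr [G e].
have [c hc] := iso_has_table (hyperfield_iso_sym e) Hr.
have q0 : c (qclass G 0) = 0%N by exact: (code0 hc).
exists (fun x => c (qclass G x)); split.
- by move=> x; exact: code_lt hc _.
- by move=> k /(code_surj hc)[A <-]; have [a ->] := Defs.quotP A; exists a.
- move=> x; split=> [|->//].
  by rewrite -{1}q0 => /(code_inj hc); exact: qclass_eq0.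
- exact: code1 hc.
- by move=> x y; rewrite -quot_mulE; exact: codeM hc _ _.
- move=> x y; apply/(codeD hc)/quot_addP; exists 1, 1.
  by rewrite !mulr1; split=> //; exact: usubg1.
- move=> _ _ _
    /(code_surj hc)[A <-] /(code_surj hc)[B <-] /(code_surj hc)[C <-].
  have [a ->] := Defs.quotP A; have [b ->] := Defs.quotP B.
  have [z ->] := Defs.quotP C.
  move=> /(codeD hc)/quot_addP[g [h [Gg Gh ->]]]; exists (a * g), (b * h).
  by rewrite !qclass_mulg.
Qed.

(** * Quotients of prime fields, checked by computation *)

(** [L] lists the codes of 0, ..., [p - 1]. The tests are the clauses of [field_code], on naturals
    modulo [p] so that they compute. *)
Definition prime_field_table (p m : nat) (r : seq bool) (L : seq nat) : bool :=
  let f := nth 0%N L in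
  let I := iota 0 p in
  [&& all (fun k => k < m.+1)%N L && all_code m (fun k => k \in L),
      all (fun x => (f x == 0%N) == (x == 0%N)) I && (f 1 == 1)%N,
      all (fun x => all (fun y =>
        f ((x * y) %% p)%N == mulc m (f x) (f y)) I) I,
      all (fun x => all (fun y =>
        addc m r (f x) (f y) (f ((x + y) %% p)%N)) I) I
    & all_code m (fun a => all_code m (fun b => all_code m (fun c =>
        addc m r a b c ==> has (fun x => has (fun y =>
          [&& f x == a, f y == b & f ((x + y) %% p)%N == c]) I) I)))].

Lemma prime_field_code p m r L : prime p -> size L = p ->
  prime_field_table p m r L ->
  @field_code m r 'F_p (fun x => nth 0%N L x).
Proof.
move=> pp sL /and5P[/andP[/allP Llt /all_codeP Lsurj] /andP[/allP L0 /eqP L1]].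
move=> /allP LM /allP LD /all_codeP Lex.
have p1 := prime_gt1 pp.
have lt (x : 'F_p) : (x < p)%N by rewrite -{2}(Fp_cast pp).
have I (x : 'F_p) : nat_of_ord x \in iota 0 p by rewrite mem_iota lt.
have ex k : (k < p)%N -> exists x : 'F_p, x = k :> nat.
  by rewrite -{1}(Fp_cast pp) => kp; exists (Ordinal kp).
(* The modulus built into ['F_p] is [p] only through [Fp_cast]. *)
have valM (x y : 'F_p) : x * y = ((x * y) %% p)%N :> nat.
  exact: (congr1 (modn (x * y)%N) (Fp_cast pp)).
have valD (x y : 'F_p) : x + y = ((x + y) %% p)%N :> nat.
  exact: (congr1 (modn (x + y)%N) (Fp_cast pp)).
split.
- by move=> x; apply/Llt/mem_nth; rewrite sL.
- move=> k /Lsurj kL; have := kL; rewrite -index_mem sL => /ex[x xE].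
  by exists x; rewrite xE nth_index.
- move=> x; have /eqP e := L0 _ (I x).
  split=> [/eqP|->]; first by rewrite e => /eqP x0; apply/val_inj.
  by apply/eqP; rewrite (eqP (L0 _ (I 0))).
- by rewrite -[RHS]L1; congr nth; rewrite /= modn_small ?Fp_cast.
- by move=> x y; rewrite valM; apply/eqP/(allP (LM _ (I x))).
- by move=> x y; rewrite valD; apply/(allP (LD _ (I x))).
- move=> a b c am bm cm abc.
  have /all_codeP/(_ _ bm)/all_codeP/(_ _ cm)/implyP/(_ abc) := Lex _ am.
  case/hasP=> x xp /hasP[y yp /and3P[/eqP <- /eqP <- /eqP <-]].
  rewrite !mem_iota in xp yp.
  have [x' x'E] := ex _ xp; have [y' y'E] := ex _ yp.
  by exists x', y'; rewrite valD x'E y'E.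
Qed.

Lemma prime_field_quotient p m r L H : prime p -> size L = p ->
  prime_field_table p m r L -> has_table m r H -> quotient_of_finite_field H.
Proof.
move=> pp sL hL Hr; exists 'F_p.
exact: field_code_quotient (prime_field_code pp sL hL) Hr.
Qed.


(** * Tables that are not quotients of finite fields, or of any field *)

(** For known codes the list computes, so that writing one element as several sums and comparing the
    lists narrows down its class. *)
Lemma fcodeD_in m r (F : fieldType) (f : F -> nat) x y : field_code m r f ->
  f (x + y) \in [seq c <- iota 0 m.+1 | addc m r (f x) (f y) c].
Proof.
by move=> hf; rewrite mem_filter mem_iota (fcodeD hf) /=; exact: fcode_lt hf _.
Qed.

(** Dividing a pair from [fcodeD_ex] by its first entry, which has code 1, changes no code. *)
Lemma fcodeD_ex1 m r (F : fieldType) (f : F -> nat) b c : field_code m r f ->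
  (b < m.+1)%N -> (c < m.+1)%N -> addc m r 1 b c ->
  exists2 y, f y = b & f (1 + y) = c.
Proof.
move=> hf bm cm bc.
have m1 : (1 < m.+1)%N by rewrite -(fcode1 hf) (fcode_lt hf).
have [x [y [x1 <- <-]]] := fcodeD_ex hf m1 bm cm bc.
have x0 : x != 0 by apply/eqP => /(fcode_eq0 hf); rewrite x1.
have fx z : f (z / x) = f z.
  rewrite -[RHS](congr1 f (mulfVK x0 z)) (fcodeM hf _ x) x1 mulcC mulc1 //.
  exact: fcode_lt hf _.
by exists (y / x); rewrite ?fx // -[1](mulfV x0) -mulrDl fx.
Qed.

(** As [1 + 1 = {1}], all positive integers have code 1, whereas the characteristic of a finite
    field is a positive integer that vanishes in it. *)
Lemma S_table_not_finite H :
  has_table 2 S_table H -> ~ quotient_of_finite_field H.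
Proof.
move=> Hr [F /(quotient_field_code Hr)[f hf]].
have f_nat n : f n.+1%:R = 1%N.
  elim: n => [|n IHn]; first exact: fcode1 hf.
  have := fcodeD_in (n.+1%:R) 1 hf; rewrite IHn (fcode1 hf) natr1 /=.
  by rewrite inE => /eqP.
have [p pp pF] := finPcharP F.
have := f_nat p.-1; rewrite prednK ?prime_gt0 // (pcharf0 pF).
by rewrite (fcode_eq0 hf 0).2.
Qed.

Section CubicCodes.
Variables (r : seq bool) (F : fieldType) (f : F -> nat).
Hypothesis hf : field_code 3 r f.

(** The class of -1 has square 1 in a group of order 3, hence is trivial. *)
Lemma cubic_codeN x : f (- x) = f x.
Proof.
have fN1 : f (- 1) = 1%N.
  have := fcodeM hf (-1) (-1); rewrite mulrNN mulr1 (fcode1 hf).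
  by have := fcode_lt hf (-1); case: (f (-1)) => [|[|[|[|]]]].
rewrite -mulN1r (fcodeM hf) fN1 mulc1 //; exact: fcode_lt hf _.
Qed.

Lemma cubic_codeD_in x y a b : f x = a -> f y = b ->
  f (x + y) \in [seq c <- iota 0 4 | addc 3 r a b c].
Proof. by move=> <- <-; exact: fcodeD_in. Qed.

Lemma cubic_codeB_in x y a b : f x = a -> f y = b ->
  f (x - y) \in [seq c <- iota 0 4 | addc 3 r a b c].
Proof. by move=> xa yb; apply: cubic_codeD_in; rewrite ?cubic_codeN. Qed.

End CubicCodes.

(* Let [f x <> 1] and [x - 1, x + 1 \in G]. Then [x ^ 2 + x + 1] is both
   [x (x + 1) + 1] and [x ^ 2 + (x + 1)], which forces it into [G], so that
   [x ^ 3 - 1 = (x - 1) (x ^ 2 + x + 1)] is in [G]; but [x ^ 3 \in G] and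
   [G - G] does not meet [G]. In characteristic 2 any [x \in gG] with
   [x + 1 \in G] will do, otherwise [x = 2]. *)
Lemma table0110_not_quotient H :
  has_table 3 (order4_table false true true false) H -> ~ quotient_of_field H.
Proof.
move=> Hr [F /(quotient_field_code Hr)[f hf]].
have sum := @cubic_codeD_in _ _ _ hf; have sub := @cubic_codeB_in _ _ _ hf.
have M := fcodeM hf; have f1 := fcode1 hf.
have no x : f x \in [:: 2; 3]%N -> f (x - 1) = 1%N -> f (x + 1) = 1%N -> False.
  move=> xc xm xp; have q : f (x ^+ 2 + x + 1) = 1%N.
    have e1 : x ^+ 2 + x + 1 = x * (x + 1) + 1 by ring.
    have e2 : x ^+ 2 + x + 1 = x * x + (x + 1) by ring.
    have := sum _ _ _ _ (M x (x + 1)) f1; have := sum _ _ _ _ (M x x) xp.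
    rewrite -e1 -e2 xp; move: xc; rewrite !inE => /orP[] /eqP -> /=;
      by rewrite !inE => /orP[] /eqP -> /=; rewrite ?inE.
  have x3 : f (x * x * x) = 1%N.
    by rewrite !M; move: xc; rewrite !inE => /orP[] /eqP ->.
  have : f (x * x * x - 1) = 1%N.
    have -> : x * x * x - 1 = (x - 1) * (x ^+ 2 + x + 1) by ring.
    by rewrite M xm q.
  have := sub _ _ _ _ x3 f1; rewrite /= !inE.
  by move=> /or3P[] /eqP ->.
have e2 : (2 : F) = 1 + 1 by ring.
have [c2|c2] := eqVneq (2 : F) 0.
  have [x x2 x1] := fcodeD_ex1 hf (isT : 2 < 4)%N (isT : 1 < 4)%N isT.
  have x1' : x - 1 = 1 + x.
    by apply/eqP; rewrite -subr_eq0; apply/eqP; rewrite -[RHS]oppr0 -c2; ring.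
  by apply: (no x); rewrite ?x2 ?x1' // addrC.
have h2 : f 2 \in [:: 2; 3]%N.
  have := sum _ _ _ _ f1 f1; rewrite /= !inE -e2.
  case/or3P => [/eqP/(fcode_eq0 hf)/eqP|->|->]; rewrite ?orbT //.
  by rewrite (negPf c2).
apply: (no 2) => //; first by rewrite e2 addrK.
(* It remains to see that [3] is in [G]: otherwise it has the class of [2], and [4 = 3 + 1] cannot
   have the class of [2 * 2]. *)
have e4 : (2 * 2 : F) = 2 + 1 + 1 by ring.
have := sum _ _ _ _ (erefl (f (2 + 1))) f1; rewrite -e4 M.
have := sum _ _ _ _ (erefl (f 2)) f1.
by move: h2; rewrite !inE => /orP[] /eqP ->; rewrite /= !inE => /orP[] /eqP ->.
Qed.

(* Take [x \in gG] with [x + 1 \in G]: the factorisation of [x ^ 2 - 1] gives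
   [x - 1 \in g^2G], then [2 = (x + 1) - (x - 1)] is in [gG] and, comparing
   [4 = 2 * 2] with [3 + 1], [3 \in g^2G]. Now [z, z + 1 \in G] yields
   incompatible conditions on [z + 3]. *)
Lemma table1101_not_quotient H :
  has_table 3 (order4_table true true false true) H -> ~ quotient_of_field H.
Proof.
move=> Hr [F /(quotient_field_code Hr)[f hf]].
have sum := @cubic_codeD_in _ _ _ hf; have sub := @cubic_codeB_in _ _ _ hf.
have M := fcodeM hf; have f1 := fcode1 hf; have fN := cubic_codeN hf.
have f2 : f (1 + 1) = 2%N.
  have [y y1 y2] := fcodeD_ex1 hf (isT : 1 < 4)%N (isT : 2 < 4)%N isT.
  have [x x2 x1] : exists2 x, f x = 2%N & f (x + 1) = 1%N.
    by exists (- (1 + y)); rewrite ?fN // opprD addrAC addNr add0r fN.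
  have xB : f (x - 1) = 3%N.
    have := sub _ _ _ _ (M x x) f1; rewrite x2.
    have -> : x * x - 1 = (x - 1) * (x + 1) by ring.
    have := sub _ _ _ _ x2 f1; rewrite M x1.
    by rewrite /= !inE => /orP[] /eqP ->.
  have := sub _ _ _ _ x1 xB; have := sum _ _ _ _ f1 f1.
  have -> : x + 1 - (x - 1) = 1 + 1 by ring.
  by rewrite /= !inE => /or3P[] /eqP ->.
have f3 : f (1 + 1 + 1) = 3%N.
  have := sum _ _ _ _ (erefl (f (1 + 1 + 1))) f1.
  have -> : 1 + 1 + 1 + 1 = (1 + 1) * (1 + 1) :> F by ring.
  have := sum _ _ _ _ f2 f1; rewrite M f2.
  by rewrite /= !inE => /orP[] /eqP ->.
have [z z1 z11] := fcodeD_ex1 hf (isT : 1 < 4)%N (isT : 1 < 4)%N isT.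
(* [z + 2] lies in both [1 + g = {1, g^2}] and [1 + 1 = {0, 1, g}]. *)
have z2 : f (z + (1 + 1)) = 1%N.
  have := sum _ _ _ _ z1 f2; have := sum _ _ _ _ z11 f1.
  have -> : 1 + z + 1 = z + (1 + 1) by ring.
  by rewrite /= !inE => /or3P[] /eqP ->.
(* The three ways to write [z + 3] allow [{0, 1, g}], [{g, g^2}] and [{1, g^2}], which have no
   common element. *)
have := sum _ _ _ _ z11 f2; have := sum _ _ _ _ z1 f3.
have := sum _ _ _ _ z2 f1.
have -> : z + (1 + 1) + 1 = z + (1 + 1 + 1) by ring.
have -> : 1 + z + (1 + 1) = z + (1 + 1 + 1) by ring.
by rewrite /= !inE => /or3P[] /eqP ->.
Qed.

Lemma valuation_table_not_finite H :
  has_table 3 valuation_table H -> ~ quotient_of_finite_field H.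
Proof.
move=> Hr [F /(quotient_field_code Hr)[f hf]].
have sub := @cubic_codeB_in _ _ _ hf.
have M := fcodeM hf; have f1 := fcode1 hf; have fN := cubic_codeN hf.
have f0 x : f x <> 0%N -> x != 0.
  by move=> fx; apply/eqP => /(fcode_eq0 hf).
pose E : {set F} := [set x | f x == 1%N].
pose D : {set F} := [set x | f x == 2%N].
have [g g2] := fcode_surj hf (isT : 2 < 4)%N.
have leED : (#|E| <= #|D|)%N.
  have gI : injective ( *%R g) by apply: mulfI; apply: f0; rewrite g2.
  rewrite -(card_imset E gI); apply: subset_leq_card.
  apply/fintype.subsetP => w /imsetP[x + ->].
  by rewrite !inE M g2 => /eqP ->.
have fV x : f x = 2%N -> f x^-1 = 3%N.
  move=> x2; have x0 : x != 0 by apply: f0; rewrite x2.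
  have := M x x^-1; rewrite mulfV // f1 x2; have := fcode_lt hf x^-1.
  by case: (f x^-1) => [|[|[|[|]]]].
(* By [1 + g = {1, g}], if [x - 1] is not in [G] it is in [gG]; then [x^-1 - 1 = - x^-1 (x - 1)] is
   in [G]. *)
pose h x := if f (x - 1) == 1%N then x else x^-1.
(* The two branches cannot collide: [x] has code 2 and [x^-1] has code 3. *)
have hI : {in D &, injective (fun x => h x - 1)}.
  move=> x y; rewrite !inE => /eqP x2 /eqP y2 /addIr; rewrite /h.
  case: ifP => _; case: ifP => _ e //; last exact: invr_inj e.
    by have := fV _ y2; rewrite -e x2.
  by have := fV _ x2; rewrite e y2.
have sDE : [set h x - 1 | x in D]%SET \subset E :\ (-1).
  apply/fintype.subsetP => w /imsetP[x + ->]; rewrite !inE => /eqP x2.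
  have x0 : x != 0 by apply: f0; rewrite x2.
  apply/andP; split.
    rewrite -subr_eq0 opprK subrK /h; case: ifP => _ //; by rewrite invr_eq0.
  rewrite /h; case: ifPn => // xN1.
  have -> : x^-1 - 1 = - (x^-1 * (x - 1)).
    by rewrite mulrBr mulVf // mulr1 opprB.
  have := sub _ _ _ _ x2 f1; rewrite fN M (fV _ x2) /= !inE (negPf xN1) /=.
  by move=> /eqP ->.
have EN1 : -1 \in E by rewrite inE fN f1.
have := subset_leq_card sDE; rewrite card_in_imset // => leDE.
have := leq_trans leED leDE.
by rewrite [X in (X <= _)%N](cardsD1 (-1)) EN1 ltnn.
Qed.

(** * The field with four elements *)

(** The quotient of the field by the trivial group has order 4, so it has a listed table. Its sums
    are singletons, while in every listed table but [F4_table] the sum [1 + 1] contains 0 and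
    another element. *)
Lemma F4_table_finite H :
  has_table 3 F4_table H -> quotient_of_finite_field H.
Proof.
move=> Hr.
have [F charF cardF] := PrimePowerField (isT : prime 2) (isT : 0 < 2)%N.
have G0 : ~ [set 1 : F]%classic 0 by move=> /= /esym/eqP; rewrite oner_eq0.
have GM (x y : F) : x = 1 -> y = 1 -> x * y = 1 by move=> -> ->; rewrite mulr1.
have GV (x : F) : x = 1 -> x^-1 = 1 by move=> ->; rewrite invr1.
pose G := @UnitSubgroup F [set 1]%classic G0 erefl GM GV.
exists F, G.
have qI : injective (qclass G) by move=> x y /qclass_eq[_ -> ->]; rewrite mulr1.
have [rep repK] : {rep : quot_carrier G -> F & forall A, A = qclass G (rep A)}.
  by apply: (@choice _ _ (fun A x => A = qclass G x)) => A; exact: Defs.quotP.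
have : has_order (quotient_hyperfield G) 4.
  apply/card_set_bijP; exists (fun A => enum_rank (rep A) : nat); split.
  - by move=> A _ /=; rewrite (leq_trans (ltn_ord _)) // cardF.
  - move=> A B _ _ /val_inj/enum_rank_inj e; by rewrite [A]repK e -repK.
  - move=> k k4; have kF : (k < #|F|)%N by rewrite cardF.
    exists (qclass G (enum_val (Ordinal kF))) => //.
    by rewrite -(qI _ _ (repK _)) enum_valK.
move=> /(order_tables (isT : 0 < 3 <= 3)%N tables4_complete)[r rL rQ].
have [c hc] := rQ.
have one b : (b < 4)%N -> addc 3 r 1 1 0 -> addc 3 r 1 1 b -> b = 0%N.
  move=> /(code_surj hc)[B <-]; have [x ->] := Defs.quotP B => h0 hx.
  have /quot_addP[_ [_ [-> -> e0]]] :
      @hadd (quotient_hyperfield G) hone hone hzero.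
    by apply/(codeD hc); rewrite (code1 hc) (code0 hc).
  have /quot_addP[_ [_ [-> -> ->]]] :
      @hadd (quotient_hyperfield G) hone hone (qclass G x).
    by apply/(codeD hc); rewrite (code1 hc).
  by rewrite -e0 (code0 hc).
have : (r == F4_table) || has (fun b => addc 3 r 1 1 0 &&
    addc 3 r 1 1 b) [:: 1; 2; 3]%N.
  by move: r rL {hc one rQ}; apply/allP.
case/orP => [/eqP rE|/hasP[b b3 /andP[r0 rb]]].
  by rewrite rE in rQ; exact: has_table_iso Hr rQ.
have b4 : (b < 4)%N by move: b3; rewrite !inE => /or3P[] /eqP ->.
by have := one _ b4 r0 rb; move: b3; rewrite !inE => /or3P[] /eqP ->.
Qed.


(** * The 2-adic valuation modulo 3 on the rationals *)

(* [int_code] is the 2-adic valuation modulo 3, and [numq x * denq x ^+ 2]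
   differs from [x] by the cube of [denq x]. *)
Definition int_code (a : int) : nat :=
  if a == 0 then 0%N else ((logn 2 `|a|) %% 3).+1.

Definition rat_code (x : rat) : nat := int_code (numq x * denq x ^+ 2).

Lemma int_codeM a b : int_code (a * b) = mulc 3 (int_code a) (int_code b).
Proof.
rewrite /int_code mulf_eq0; case: eqVneq => [//|a0].
case: eqVneq => [_|b0]; first by [].
by rewrite /mulc /= abszM lognM ?absz_gt0 // modnDm.
Qed.

Lemma int_code_cube a b : b != 0 -> int_code (a * b ^+ 3) = int_code a.
Proof.
move=> b0; rewrite /int_code mulf_eq0 expf_eq0 (negPf b0) orbF.
case: eqP => // /eqP a0.
rewrite abszM abszX lognM ?expn_gt0 ?absz_gt0 ?b0 //.
by rewrite lognX mulnC addnC modnMDl.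
Qed.

(** With [v] the valuation of [a], both [2^v] and [2^(v+1)] divide [b], so each divides [a + b]
    exactly when it divides [a]. *)
Lemma logn_absz_add (a b : int) : a != 0 -> b != 0 ->
  (logn 2 `|a| < logn 2 `|b|)%N -> logn 2 `|a + b| = logn 2 `|a|.
Proof.
move=> a0 b0 ab.
have dvdE (k : nat) (z : int) : z != 0 ->
    ((2 ^ k)%:Z %| z)%Z = (k <= logn 2 `|z|)%N.
  by move=> z0; rewrite -pfactor_dvdn // absz_gt0.
have ab0 : a + b != 0.
  apply/eqP => /eqP; rewrite addr_eq0 => /eqP e; move: ab.
  by rewrite e abszN ltnn.
have bdvd (k : nat) : (k <= logn 2 `|b|)%N -> ((2 ^ k)%:Z %| b)%Z.
  by rewrite dvdE.
apply/eqP; rewrite eqn_leq leqNgt -!dvdE // !rpredDr ?bdvd // ?dvdE ?ltnn //.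
  by rewrite leqnn.
exact: ltnW.
Qed.

(** In this table two equal nonzero classes sum to everything, two distinct ones to just
    themselves. *)
Lemma valuation_table_add a b c : (0 < a < 4)%N -> (0 < b < 4)%N -> (c < 4)%N ->
  (a != b -> (c == a) || (c == b)) -> addc 3 valuation_table a b c.
Proof.
by case: a => [|[|[|[|a]]]] //; case: b => [|[|[|[|b]]]] //;
  case: c => [|[|[|[|c]]]] // _ _ _ => /(_ isT).
Qed.

Lemma int_code_lt a : (int_code a < 4)%N.
Proof. by rewrite /int_code; case: ifP => // _; rewrite ltnS ltn_pmod. Qed.

Lemma int_code_eq0 a : (int_code a = 0)%N <-> a = 0.
Proof. by rewrite /int_code; case: eqP. Qed.

(** Distinct codes mean distinct valuations, and the sum then has the smaller one. *)
Lemma int_code_add a b : addc 3 valuation_table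
  (int_code a) (int_code b) (int_code (a + b)).
Proof.
have [->|a0] := eqVneq a 0; first by rewrite add0r /addc /= eqxx.
have [->|b0] := eqVneq b 0.
  by rewrite addr0 /addc {1}/int_code (negPf a0) /= eqxx.
have gt0 z : z != 0 -> (0 < int_code z < 4)%N.
  by move=> z0; rewrite int_code_lt /int_code (negPf z0).
apply: valuation_table_add; rewrite ?gt0 ?int_code_lt // => ab.
have ab0 : a + b != 0.
  apply: contraNneq ab => /eqP; rewrite addr_eq0 => /eqP ->.
  by rewrite /int_code oppr_eq0 abszN.
rewrite /int_code (negPf a0) (negPf b0) (negPf ab0).
case: (ltngtP (logn 2 `|a|) (logn 2 `|b|)) => [lt|lt|e].
- by rewrite logn_absz_add // eqxx.
- by rewrite addrC logn_absz_add // eqxx orbT.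
- by move: ab; rewrite /int_code (negPf a0) (negPf b0) e eqxx.
Qed.

(** The fraction need not be reduced: if [n / q] is its reduced form, then [n d = p q] gives
    [n q^2 d^3 = p d^2 q^3], and cubes do not affect the code. *)
Lemma rat_codeE p d : d != 0 -> rat_code (p%:Q / d%:Q) = int_code (p * d ^+ 2).
Proof.
move=> d0; set x := _ / _; have xE : numq x * d = p * denq x.
  have dq0 : d%:Q != 0 by rewrite intr_eq0.
  have nq0 : (denq x)%:Q != 0 by rewrite intr_eq0 denq_neq0.
  apply/eqP; rewrite -(eqr_int rat) !intrM; apply/eqP.
  have := divq_num_den x; rewrite {3}/x => e.
  by apply: (mulIf (invr_neq0 nq0)); rewrite mulrAC e [RHS]mulfK // divfK.
rewrite /rat_code -(int_code_cube _ d0) -(int_code_cube (p * _) (denq_neq0 x)).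
congr int_code.
transitivity ((numq x * d) * (denq x ^+ 2 * d ^+ 2)); first by ring.
by rewrite xE; ring.
Qed.

Lemma rat_field_code : field_code 3 valuation_table rat_code.
Proof.
have q0 (x : rat) : denq x != 0 by exact: denq_neq0.
have fint (z : int) : rat_code z%:Q = int_code z.
  by rewrite -[z%:Q]divr1 (@rat_codeE z 1) // mulr1.
have xE (x : rat) : x = (numq x)%:Q / (denq x)%:Q by rewrite divq_num_den.
have r0 (x : rat) : (denq x)%:Q != 0 by rewrite intr_eq0.
split.
- by move=> x; exact: int_code_lt.
- by case=> [|[|[|[|]]]] // _; [exists 0|exists 1|exists 2%:Q|exists 4%:Q];
    rewrite (fint 0, fint 1, fint 2, fint 4).
- move=> x; rewrite /rat_code int_code_eq0; split=> [/eqP|->] //.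
  by rewrite mulf_eq0 expf_eq0 (negPf (q0 x)) orbF numq_eq0 => /eqP.
- exact: (fint 1).
- move=> x y; rewrite /rat_code -int_codeM [in LHS](xE x) [in LHS](xE y).
  rewrite mulf_div -!intrM -/(rat_code _) rat_codeE ?mulf_neq0 //.
  by congr int_code; ring.
- move=> x y; have -> : rat_code (x + y) = int_code
      (numq x * denq x ^+ 2 * denq y ^+ 3 + numq y * denq y ^+ 2 * denq x ^+ 3).
    rewrite [in LHS](xE x) [in LHS](xE y) addf_div // -!intrM -intrD.
    by rewrite rat_codeE ?mulf_neq0 //; congr int_code; ring.
  rewrite /rat_code -(int_code_cube (numq x * _) (q0 y)).
  rewrite -(int_code_cube (numq y * _) (q0 x)); exact: int_code_add.
- move=> a b c a4 b4 c4 abc.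
  (* Sums of these integers realise every triple of classes that the table allows. *)
  pose I : seq int := [:: 0; 1; 2; 4; 8; 16; 32; 3; 6; 12; -1; -2; -4].
  have : all_code 3 (fun a => all_code 3 (fun b => all_code 3 (fun c =>
      addc 3 valuation_table a b c ==> has (fun x => has (fun y =>
      [&& int_code x == a, int_code y == b & int_code (x + y) == c]) I) I))).
    by vm_compute.
  move=> /all_codeP/(_ _ a4)/all_codeP/(_ _ b4)/all_codeP/(_ _ c4).
  move=> /implyP/(_ abc)/hasP[x _ /hasP[y _ /and3P[/eqP <- /eqP <- /eqP <-]]].
  by exists x%:Q, y%:Q; rewrite -intrD !fint.
Qed.

(** * Signs of real numbers *)

Section RealSigns.
Variable R : realType.

Definition sign_code (x : R) : nat :=
  if x == 0 then 0%N else if 0 < x then 1%N else 2%N.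

Lemma sign_field_code : field_code 2 S_table sign_code.
Proof.
have pos x : 0 < x -> sign_code x = 1%N.
  by move=> x0; rewrite /sign_code gt_eqF // x0.
have neg x : x < 0 -> sign_code x = 2%N.
  by move=> x0; rewrite /sign_code lt_eqF // ltNge (ltW x0).
have zero : sign_code 0 = 0%N by rewrite /sign_code eqxx.
have N10 : (-1 : R) < 0 by rewrite oppr_lt0.
split.
- by move=> x; rewrite /sign_code; do 2?case: ifP.
- move=> [|[|[|k]]] // _; [exists 0|exists 1|exists (-1)].
  + exact: zero.
  + exact: pos ltr01.
  + exact: neg N10.
- move=> x; split=> [|->//]; rewrite /sign_code.
  by case: eqP => // _; case: ifP.
- exact: pos ltr01.
- move=> x y; case: (ltgtP x 0) => [x0|x0|->]; last by rewrite mul0r zero.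
    case: (ltgtP y 0) => [y0|y0|->]; last by rewrite mulr0 zero (neg _ x0).
      by rewrite (neg _ x0) (neg _ y0) pos // nmulr_rgt0.
    by rewrite (neg _ x0) (pos _ y0) neg // nmulr_rlt0.
  case: (ltgtP y 0) => [y0|y0|->]; last by rewrite mulr0 zero (pos _ x0).
    by rewrite (pos _ x0) (neg _ y0) neg // pmulr_rlt0.
  by rewrite (pos _ x0) (pos _ y0) pos // mulr_gt0.
- move=> x y; case: (ltgtP x 0) => [x0|x0|->]; last first.
  + by rewrite add0r zero /addc /= eqxx.
  + case: (ltgtP y 0) => [y0|y0|->].
    * rewrite (pos _ x0) (neg _ y0); have : (sign_code (x + y) < 3)%N.
        by rewrite /sign_code; do 2?case: ifP.
      by case: (sign_code _) => [|[|[|]]].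
    * by rewrite (pos _ x0) (pos _ y0) pos // addr_gt0.
    * by rewrite addr0 zero (pos _ x0).
  + case: (ltgtP y 0) => [y0|y0|->].
    * rewrite (neg _ x0) (neg _ y0) neg //.
      by rewrite -oppr_gt0 opprD addr_gt0 ?oppr_gt0.
    * rewrite (neg _ x0) (pos _ y0); have : (sign_code (x + y) < 3)%N.
        by rewrite /sign_code; do 2?case: ifP.
      by case: (sign_code _) => [|[|[|]]].
    * by rewrite addr0 zero (neg _ x0).
- move=> a b c a3 b3 c3 abc.
  pose f (z : int) := if z == 0 then 0%N else if 0 < z then 1%N else 2%N.
  have fE z : sign_code z%:~R = f z by rewrite /sign_code intr_eq0 ltr0z.
  pose I : seq int := [:: 0; 1; 2; -1; -2].
  have : all_code 2 (fun a => all_code 2 (fun b => all_code 2 (fun c =>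
      addc 2 S_table a b c ==> has (fun x => has (fun y =>
      [&& f x == a, f y == b & f (x + y) == c]) I) I))) by vm_compute.
  move=> /all_codeP/(_ _ a3)/all_codeP/(_ _ b3)/all_codeP/(_ _ c3).
  move=> /implyP/(_ abc)/hasP[x _ /hasP[y _ /and3P[/eqP <- /eqP <- /eqP <-]]].
  by exists x%:~R, y%:~R; rewrite -intrD !fE.
Qed.

End RealSigns.

(** * The named hyperfields and the status of each table *)

Lemma has_table_krasner : has_table 1 K_table krasner.
Proof.
exists nat_of_bool; split=> //=; do ?[by case].
- by move=> [] [].
- by move=> [|[|k]] // _; [exists false|exists true].
- by move=> [] [].
- by move=> [] [] [].
Qed.

Lemma has_table_signs : has_table 2 S_table signs.
Proof.
exists (fun x => match x with SZero => 0 | SPos => 1 | SNeg => 2 end)%N.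
split=> //=; do ?[by case].
- by move=> [] [].
- by move=> [|[|[|k]]] // _; [exists SZero|exists SPos|exists SNeg].
- by move=> [] [].
- by move=> [] [] [].
Qed.

Lemma has_table_F2 : has_table 1 F2_table (field_hyperfield 'F_2).
Proof.
exists val; split=> //=.
- exact: val_inj.
- by move=> k k2; exists (Ordinal k2).
- by move=> [[|[|?]] ?] [[|[|?]] ?].
- move=> x y z; split=> [->|h].
    by case: x y => [[|[|?]] ?] [[|[|?]] ?].
  apply/val_inj; move: h.
  by case: x y z => [[|[|?]] ?] [[|[|?]] ?] [[|[|?]] ?].
Qed.

Lemma quotient_of_finite_is_quotient H :
  quotient_of_finite_field H -> quotient_of_field H.
Proof. by move=> [F HF]; exists F. Qed.

Lemma tables2_finite r H :
  r \in tables2 -> has_table 1 r H -> quotient_of_finite_field H.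
Proof.
rewrite !inE => /orP[] /eqP ->.
  (* The Krasner hyperfield is the quotient of [F_3] by all its units. *)
  exact: (@prime_field_quotient 3 _ _ [:: 0; 1; 1]%N).
exact: (@prime_field_quotient 2 _ _ [:: 0; 1]%N).
Qed.

(* The lists below give the class of each element of the prime field: [0] for
   [0], and [k + 1] for the coset of [g ^ k], [g] being a primitive root. *)
Lemma tables3_finite r H : r \in tables3 -> has_table 2 r H ->
  quotient_of_finite_field H <-> r != S_table.
Proof.
rewrite in_cons => /predU1P[-> HS|].
  by split=> // /(S_table_not_finite HS).
rewrite !inE => /or4P[] /eqP -> Hr; split=> // _; move: Hr.
- exact: (@prime_field_quotient 3 _ _ [:: 0; 1; 2]%N).
- exact: (@prime_field_quotient 7 _ _ [:: 0; 1; 1; 2; 1; 2; 2]%N).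
- exact: (@prime_field_quotient 5 _ _ [:: 0; 1; 2; 2; 1]%N).
- exact: (@prime_field_quotient 13 _ _
    [:: 0; 1; 2; 1; 1; 2; 2; 2; 2; 1; 1; 2; 1]%N).
Qed.

Lemma finite_tables4_finite r H :
  r \in finite_tables4 -> has_table 3 r H -> quotient_of_finite_field H.
Proof.
rewrite !inE => /or4P[] /eqP ->.
- exact: F4_table_finite.
- exact: (@prime_field_quotient 7 _ _ [:: 0; 1; 3; 2; 2; 3; 1]%N).
- exact: (@prime_field_quotient 13 _ _
    [:: 0; 1; 2; 2; 3; 1; 3; 3; 1; 3; 2; 2; 1]%N).
- exact: (@prime_field_quotient 19 _ _
    [:: 0; 1; 2; 2; 3; 2; 3; 1; 1; 3; 3; 1; 1; 3; 2; 3; 2; 2; 1]%N).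
Qed.

Lemma nonquotient_tables4_not_quotient r H :
  r \in nonquotient_tables4 -> has_table 3 r H -> ~ quotient_of_field H.
Proof.
rewrite !inE => /orP[] /eqP ->.
  exact: table0110_not_quotient.
exact: table1101_not_quotient.
Qed.

Lemma valuation_table_infinite H :
  has_table 3 valuation_table H -> quotient_of_infinite_field H.
Proof.
move=> Hv; exists rat; first exact: infinite_rat.
exact: field_code_quotient rat_field_code Hv.
Qed.

Lemma tables4_finite r H : r \in tables4 -> has_table 3 r H ->
  quotient_of_finite_field H <-> r \in finite_tables4.
Proof.
rewrite mem_cat => /orP[rf Hr|rn Hr].
  by rewrite rf; split=> // _; exact: finite_tables4_finite rf Hr.
split=> [Hf|rf]; last exact: finite_tables4_finite rf Hr.
move: rn; rewrite in_cons => /predU1P[rv|rn].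
  by rewrite rv in Hr; case: (valuation_table_not_finite Hr).
case: (nonquotient_tables4_not_quotient rn Hr).
exact: quotient_of_finite_is_quotient.
Qed.

Lemma tables4_quotient r H : r \in tables4 -> has_table 3 r H ->
  ~ quotient_of_field H <-> r \in nonquotient_tables4.
Proof.
rewrite mem_cat in_cons => /or3P[rf|/eqP rv|rn] Hr.
- split=> [[]|rn]; last exact: nonquotient_tables4_not_quotient rn Hr.
  exact/quotient_of_finite_is_quotient/(finite_tables4_finite rf Hr).
- rewrite rv in Hr *; split=> // -[].
  by have [F _ HF] := valuation_table_infinite Hr; exists F.
- by split=> // _; exact: nonquotient_tables4_not_quotient rn Hr.
Qed.

(** * The classification *)

Theorem theorem1p2 (R : realType) :
  [/\ num_iso_classes (fun H => has_order H 2) 2,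
      forall H : hyperfield, has_order H 2 <->
        hyperfield_iso H krasner \/ hyperfield_iso H (field_hyperfield 'F_2),
      quotient_of_finite_field krasner
    & quotient_of_finite_field (field_hyperfield 'F_2)]
  /\
  [/\ forall H : hyperfield, has_order H 3 -> quotient_of_field H,
      num_iso_classes (fun H => has_order H 3) 5,
      num_iso_classes
        (fun H => has_order H 3 /\ ~ quotient_of_finite_field H) 1,
      hyperfield_iso signs (quotient_hyperfield (pos_reals R))
    & ~ quotient_of_finite_field signs]
  /\
  [/\ num_iso_classes (fun H => has_order H 4) 7,
      num_iso_classes
        (fun H => has_order H 4 /\ quotient_of_finite_field H) 4,
      num_iso_classes
        (fun H => [/\ has_order H 4, quotient_of_infinite_field H
                    & ~ quotient_of_finite_field H]) 1
    & num_iso_classes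
        (fun H => has_order H 4 /\ ~ quotient_of_field H) 2].
Proof.
have S2 := @order_tablesP 1 tables2 _ isT tables2_complete.
have S3 := @order_tablesP 2 tables3 _ isT tables3_complete.
have HS := has_table_signs.
split; [split|split; split].
- apply: (num_iso_classes_order (L' := tables2) tables2_complete) => //.
  + move=> r H r2 Hr; rewrite r2; split=> // _; exact: has_table_order Hr.
- move=> H; split.
    move/S2 => [r]; rewrite !inE => /orP[] /eqP -> Hr; [left|right].
      exact: has_table_iso Hr has_table_krasner.
    exact: has_table_iso Hr has_table_F2.
  case=> HH; apply: has_table_order (iso_has_table HH _).
    exact: has_table_krasner.
  exact: has_table_F2.
- exact: tables2_finite has_table_krasner.
- exact: tables2_finite has_table_F2.
- move=> H /S3[r r3 Hr]; have [rS|rS] := eqVneq r S_table.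
    rewrite rS in Hr; exists R.
    exact: field_code_quotient (sign_field_code R) Hr.
  exact/quotient_of_finite_is_quotient/(tables3_finite r3 Hr).
- apply: (num_iso_classes_order (L' := tables3) tables3_complete) => //.
  + move=> r H r3 Hr; rewrite r3; split=> // _; exact: has_table_order Hr.
- apply: (num_iso_classes_order (L' := [:: S_table]) tables3_complete) => //.
  + by move=> H [].
  + move=> r H r3 Hr; rewrite inE; split=> [[_ Hn]|/eqP rS].
      by apply/negPn/negP => /(tables3_finite r3 Hr).
    rewrite rS in Hr; split; first exact: has_table_order Hr.
    exact: S_table_not_finite.
(* Both sides have the table [S_table]: the positive reals are the elements of [sign_code] 1. *)
- apply: has_table_iso HS _.
  apply: (field_code_quotient_table (sign_field_code R)) => x /=.
  by rewrite /sign_code; case: ltgtP.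
- exact: S_table_not_finite HS.
- apply: (num_iso_classes_order (L' := tables4) tables4_complete) => //.
  + move=> r H r4 Hr; rewrite r4; split=> // _; exact: has_table_order Hr.
- apply: (num_iso_classes_order (L' := finite_tables4) tables4_complete) => //.
  + by move=> H [].
  + move=> r H r4 Hr; rewrite -(tables4_finite r4 Hr); split=> [[]|Hq] //.
    by split=> //; exact: has_table_order Hr.
- pose L' := [:: valuation_table].
  apply: (num_iso_classes_order (L' := L') tables4_complete) => //.
  + by move=> H [].
  + move=> r H r4 Hr; split=> [[_ [F _ HF] Hn]|].
      (* Of the seven tables only [valuation_table] survives the two exclusions. *)
      have rq : r \notin nonquotient_tables4.
        by apply/negP => /(tables4_quotient r4 Hr); apply; exists F.
      have rf : r \notin finite_tables4.
        by apply/negP => /(tables4_finite r4 Hr).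
      by move: r4; rewrite mem_cat (negPf rf) in_cons (negPf rq) orbF inE.
    rewrite inE => /eqP rv; rewrite rv in Hr; split.
    * exact: has_table_order Hr.
    * exact: valuation_table_infinite.
    * exact: valuation_table_not_finite.
- pose L' := nonquotient_tables4.
  apply: (num_iso_classes_order (L' := L') tables4_complete) => //.
  + by move=> H [].
  + move=> r H r4 Hr; rewrite -(tables4_quotient r4 Hr); split=> [[]|Hq] //.
    by split=> //; exact: has_table_order Hr.
Qed.
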